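(* Let $\phi_0\in(21/10,3]$ and $\beta_0>0$. There exists $\varepsilon(\phi_0,\beta_0)>0$ such that the following holds. If $\mu\in\mathbb R$ and $(\mathbf u_i,p_i)\in C^\infty(\mathbb R^2\setminus\overline B)\times C^\infty(\mathbb R^2\setminus\overline B)$, $i=a,b$, are solutions of the stationary exterior Navier–Stokes problem with the same boundary data $\mathbf u^*\in C^\infty(\partial B)$, and such that $\mathbf v_i=\mathbf u_i-\mathbf u_{ref}[\phi_0,\mu]$ satisfy $$\sup_{|x|\ge1}|x|^{1+\beta_0}\Big(|\mathbf v_a(x)|+|\mathbf v_b(x)|+|x|\big(|\nabla\mathbf v_a(x)|+|\nabla\mathbf v_b(x)|\big)+|x|^2\big(|\nabla^2\mathbf v_a(x)|+|\nabla^2\mathbf v_b(x)|\big)\Big)+|\mu|<\varepsilon(\phi_0,\beta_0),$$ then $\mathbf u_b=\mathbf u_a$.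
   Context: $B=B(0,1)\subset\mathbb R^2$ is the unit disk, $(r,\theta)$ are polar coordinates with local basis $(\mathbf e_r,\mathbf e_\theta)$. The stationary exterior Navier–Stokes problem with boundary data $\mathbf u^*$ is $$(\mathbf u\cdot\nabla)\mathbf u+\nabla p=\Delta\mathbf u,\quad \mathrm{div}\,\mathbf u=0\ \text{ in }\mathbb R^2\setminus\overline B,\qquad \mathbf u=\mathbf u^*\ \text{on }\partial B,\qquad \mathbf u\to0\ \text{at infinity}.$$ For $\phi,\mu\in\mathbb R$: $\mathbf u_{ref}[\phi,\mu](r,\theta)=-\dfrac{\phi}{r}\mathbf e_r+\dfrac{\mu}{r}\mathbf e_\theta$. *)

(* Defs.v *)
From Stdlib Require Import Reals.
From Coquelicot Require Import Coquelicot.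
Open Scope R_scope.

(** Points of the plane are given by their Cartesian coordinates [x y], and
    vector fields by their Cartesian components.  Functions are total: only
    their values on the closed exterior [1 <= rad x y] are ever used. *)

Definition scalar_field := R -> R -> R.
Definition vector_field := R -> R -> R * R.

Definition comp1 (u : vector_field) : scalar_field := fun x y => fst (u x y).
Definition comp2 (u : vector_field) : scalar_field := fun x y => snd (u x y).

Definition rad (x y : R) : R := sqrt (x ^ 2 + y ^ 2).

Definition e_r (x y : R) : R * R := (x / rad x y, y / rad x y).
Definition e_theta (x y : R) : R * R := (- y / rad x y, x / rad x y).

Definition u_ref (phi mu : R) : vector_field := fun x y =>
  (- (phi / rad x y) * fst (e_r x y) + mu / rad x y * fst (e_theta x y),
   - (phi / rad x y) * snd (e_r x y) + mu / rad x y * snd (e_theta x y)).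

Definition vf_sub (u w : vector_field) : vector_field := fun x y =>
  (comp1 u x y - comp1 w x y, comp2 u x y - comp2 w x y).

(** [ex_diff_n f n x y]: the iterated partial derivatives of [f] of order at
    most [n] exist and are continuous at [(x, y)].  The exterior being open,
    this is membership in C^oo (R^2 \ closure B); nothing is required of the
    derivatives at the boundary. *)
Definition smooth_ext (f : scalar_field) : Prop :=
  forall (n : nat) (x y : R), 1 < rad x y -> ex_diff_n f n x y.

Definition smooth_vector_ext (u : vector_field) : Prop :=
  smooth_ext (comp1 u) /\ smooth_ext (comp2 u).

(** Smoothness on the unit circle, through its standard parametrization.
    Values of [ustar] away from the circle are irrelevant. *)
Definition smooth_circle (ustar : vector_field) : Prop :=
  forall (n : nat) (t : R),
    ex_derive_n (fun s => comp1 ustar (cos s) (sin s)) n t /\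
    ex_derive_n (fun s => comp2 ustar (cos s) (sin s)) n t.

Definition convect (u : vector_field) (f : scalar_field) : scalar_field :=
  fun x y => comp1 u x y * partial_derive 1 0 f x y
           + comp2 u x y * partial_derive 0 1 f x y.

Definition laplacian (f : scalar_field) : scalar_field :=
  fun x y => partial_derive 2 0 f x y + partial_derive 0 2 f x y.

Definition divergence (u : vector_field) : scalar_field :=
  fun x y => partial_derive 1 0 (comp1 u) x y + partial_derive 0 1 (comp2 u) x y.

(** The boundary condition is attained continuously from the exterior:
    [u] is continuous on the closed exterior and equals [ustar] on the circle. *)
Definition ext_NS_solution (ustar u : vector_field) (p : scalar_field) : Prop :=
  (forall x y : R, 1 < rad x y ->
     convect u (comp1 u) x y + partial_derive 1 0 p x y = laplacian (comp1 u) x y /\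
     convect u (comp2 u) x y + partial_derive 0 1 p x y = laplacian (comp2 u) x y /\
     divergence u x y = 0) /\
  continuous_on (fun z : R * R => 1 <= rad (fst z) (snd z))
                (fun z : R * R => u (fst z) (snd z)) /\
  (forall x y : R, rad x y = 1 -> u x y = ustar x y) /\
  (forall eps : R, 0 < eps -> exists M : R, forall x y : R,
     M < rad x y -> 1 < rad x y -> rad (comp1 u x y) (comp2 u x y) < eps).

Definition abs_vf (v : vector_field) : scalar_field := fun x y =>
  rad (comp1 v x y) (comp2 v x y).

Definition abs_grad (v : vector_field) : scalar_field := fun x y =>
  sqrt ( partial_derive 1 0 (comp1 v) x y ^ 2 + partial_derive 0 1 (comp1 v) x y ^ 2
       + partial_derive 1 0 (comp2 v) x y ^ 2 + partial_derive 0 1 (comp2 v) x y ^ 2).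

(** Euclidean norm of the tensor of all second derivatives; each mixed
    derivative occurs twice in it. *)
Definition abs_hess (v : vector_field) : scalar_field := fun x y =>
  sqrt ( partial_derive 2 0 (comp1 v) x y ^ 2 + 2 * partial_derive 1 1 (comp1 v) x y ^ 2
       + partial_derive 0 2 (comp1 v) x y ^ 2
       + partial_derive 2 0 (comp2 v) x y ^ 2 + 2 * partial_derive 1 1 (comp2 v) x y ^ 2
       + partial_derive 0 2 (comp2 v) x y ^ 2).

Definition weighted_size (beta : R) (va vb : vector_field) : scalar_field :=
  fun x y =>
    Rpower (rad x y) (1 + beta)
    * ( (abs_vf va x y + abs_vf vb x y)
      + rad x y * (abs_grad va x y + abs_grad vb x y)
      + rad x y ^ 2 * (abs_hess va x y + abs_hess vb x y)).

(** The supremum, possibly [p_infty], of the weighted size over the exterior.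
    It runs over the open exterior, where the derivatives make sense; for
    fields that are C^2 up to the circle, whose boundary derivatives are the
    limits from outside, this is also the supremum over [1 <= rad x y]. *)
Definition weighted_sup (beta : R) (va vb : vector_field) : Rbar :=
  Lub_Rbar (fun s : R => exists x y : R,
    1 < rad x y /\ s = weighted_size beta va vb x y).

(* Main.v *)
Require Import Defs.
From Stdlib Require Import Reals Lra.
From Coquelicot Require Import Coquelicot.
Open Scope R_scope.

(** Let [w = ub - ua], [k = phi - 2 > 0], [t = ln r], and let [va], [vb] be the
    deviations of the two solutions from the reference field.  The argument is a
    single energy identity: the vorticity equation for [w] is multiplied by [r^2 psi],
    where [psi] is the stream function of [w].

    In the coordinates [(t, theta)] put [g = r w_theta], [f = r w_r] and
    [z = r^2 curl w].  Then [psi_t = g], [psi_theta = - f] and [z = g_t - f_theta].  The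
    reference field is irrotational with constant [r u_r = - phi], [r u_theta = mu], so
    the linear part of the equation has constant coefficients.  The momentum equation,
    written with the head pressure [p + |u|^2 / 2], expresses the derivatives of the
    difference [Pi] of the two head pressures as

      [a = r^2 Pi_theta = z_t + k z - F z - f Om],
      [b = r^2 Pi_t = - z_theta + (mu + G) z + g Om],

    where [F], [G] are [r] times the polar components of [vb] and [Om = r^2 curl va].
    These three coefficients are bounded by a multiple of [eps exp (- beta t)].
    Equality of the mixed derivatives of [Pi] gives [a_t - b_theta = 2 a], and expanding
    [(psi a)_t - (psi b)_theta] yields, modulo a divergence [Q_t + S_theta], the identity

      [Q_t + S_theta = - z^2 - 2 k (g^2 + f^2) + G z f - F z (g + 2 psi) - 2 f Om psi].

    The terms in [mu] are themselves a divergence, and the condition [phi > 2] is what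
    makes the quadratic form definite.  The perturbation involves [psi] without
    derivative, but with the weight [exp (- beta t)]; it is absorbed after adding
    [(k beta / 4) exp (- beta t) psi^2] to [Q], which amounts to a Hardy inequality.

    The integral of [Q] over the circle of radius [exp t] is therefore decreasing in
    [t], with derivative at most [- k] times the integral of [g^2 + f^2].  It tends to
    zero at the circle, where [g], [f], [psi] vanish linearly while the second
    derivatives of [w] stay bounded, and at infinity, where [psi] is bounded and all the
    other quantities decay.  Hence it is constant and [g = f = 0].

    The energy identity is [density_identity], its coercivity [density_bound], and the
    conclusion for the polar system [polar_system_unique]; [stream_spec] constructs the
    stream function and [polar_dynamics] derives the system from the equations. *)

(** * Smooth functions on the exterior of the disk *)

Definition dx (f : scalar_field) : scalar_field := partial_derive 1 0 f.
Definition dy (f : scalar_field) : scalar_field := partial_derive 0 1 f.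

(** The open exterior of the unit disk. *)
Definition exterior (x y : R) : Prop := 1 < rad x y.

(** Equality of two scalar fields on the open exterior, the only region where
    derivatives are taken. *)
Definition eqx (f g : scalar_field) : Prop := forall x y, exterior x y -> f x y = g x y.

(** Class C^n on the open exterior. *)
Definition class_C (n : nat) (f : scalar_field) : Prop :=
  forall x y, exterior x y -> ex_diff_n f n x y.

(** Pointwise algebra of scalar fields.  Working with these combinators lets the
    rules of differentiation act by first-order rewriting. *)
Definition f_const (c : R) : scalar_field := fun _ _ => c.
Definition coord_x : scalar_field := fun x _ => x.
Definition coord_y : scalar_field := fun _ y => y.
Definition f_add (f g : scalar_field) : scalar_field := fun x y => f x y + g x y.
Definition f_sub (f g : scalar_field) : scalar_field := fun x y => f x y - g x y.
Definition f_mul (f g : scalar_field) : scalar_field := fun x y => f x y * g x y.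
Definition f_inv (f : scalar_field) : scalar_field := fun x y => / f x y.

Lemma exterior_sq x y : exterior x y <-> 1 < x ^ 2 + y ^ 2.
Proof.
unfold exterior, rad; split; intros H.
- apply Rnot_le_lt; intros H1.
  apply (Rlt_not_le _ _ H). rewrite <- sqrt_1. apply sqrt_le_1_alt; exact H1.
- rewrite <- sqrt_1. apply sqrt_lt_1_alt. lra.
Qed.

Lemma exterior_open x y : exterior x y -> locally_2d exterior x y.
Proof.
intros H.
assert (C : continuity_2d_pt (fun x y => x ^ 2 + y ^ 2) x y).
{ apply continuity_2d_pt_plus; simpl;
  repeat first [ apply continuity_2d_pt_mult | apply continuity_2d_pt_id1
    | apply continuity_2d_pt_id2 | apply continuity_2d_pt_const ]. }
apply exterior_sq in H.
destruct (C (mkposreal (x ^ 2 + y ^ 2 - 1) ltac:(lra))) as [d Hd]; simpl in Hd.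
exists d. intros u v Hu Hv. apply exterior_sq.
generalize (Hd u v Hu Hv). intros K. apply Rabs_def2 in K. lra.
Qed.

Lemma exterior_locally_2d (P : R -> R -> Prop) x y :
  (forall u v, exterior u v -> P u v) -> exterior x y -> locally_2d P x y.
Proof.
intros HP H. destruct (exterior_open x y H) as [d Hd].
exists d. intros; apply HP, Hd; assumption.
Qed.

Lemma class_C_eqx n f g : eqx f g -> class_C n f -> class_C n g.
Proof.
intros E H x y Hxy. apply (ex_diff_n_ext_loc f); [|apply H, Hxy].
apply exterior_locally_2d; assumption.
Qed.

Lemma eqx_sym f g : eqx f g -> eqx g f.
Proof. intros E x y H; symmetry; apply E, H. Qed.

Lemma dx_eqx f g : eqx f g -> eqx (dx f) (dx g).
Proof.
intros E x y H. apply partial_derive_ext_loc, exterior_locally_2d; assumption.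
Qed.

Lemma dy_eqx f g : eqx f g -> eqx (dy f) (dy g).
Proof.
intros E x y H. apply partial_derive_ext_loc, exterior_locally_2d; assumption.
Qed.

Lemma class_C_0 f : (forall x y, exterior x y -> continuity_2d_pt f x y) -> class_C 0 f.
Proof. intros H x y Hxy; split; auto. Qed.

Lemma class_C_cont n f x y : class_C n f -> exterior x y -> continuity_2d_pt f x y.
Proof. intros H Hxy; destruct n; apply (H x y Hxy). Qed.

Lemma class_C_S n f :
  class_C 0 f ->
  (forall x y, exterior x y -> is_derive (fun s => f s y) x (dx f x y)
                       /\ is_derive (fun s => f x s) y (dy f x y)) ->
  class_C n (dx f) -> class_C n (dy f) -> class_C (S n) f.
Proof.
intros H0 Hd H1 H2 x y Hxy. split; [apply (H0 x y Hxy)|].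
destruct (Hd x y Hxy). repeat split.
- eexists; eassumption.
- eexists; eassumption.
- apply (H1 x y Hxy).
- apply (H2 x y Hxy).
Qed.

Lemma class_C_is_derive_x n f x y : class_C (S n) f -> exterior x y ->
  is_derive (fun s => f s y) x (dx f x y).
Proof. intros H Hxy. apply Derive_correct. apply (H x y Hxy). Qed.

Lemma class_C_is_derive_y n f x y : class_C (S n) f -> exterior x y ->
  is_derive (fun s => f x s) y (dy f x y).
Proof. intros H Hxy. apply Derive_correct. apply (H x y Hxy). Qed.

Lemma class_C_dx n f : class_C (S n) f -> class_C n (dx f).
Proof. intros H x y Hxy; apply (H x y Hxy). Qed.

Lemma class_C_dy n f : class_C (S n) f -> class_C n (dy f).
Proof. intros H x y Hxy; apply (H x y Hxy). Qed.

Lemma class_C_down n : forall f, class_C (S n) f -> class_C n f.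
Proof.
induction n; intros f H.
- apply class_C_0; intros; eapply class_C_cont; eauto.
- apply class_C_S.
  + apply class_C_0; intros; eapply class_C_cont; eauto.
  + intros; split; [eapply class_C_is_derive_x|eapply class_C_is_derive_y]; eauto.
  + apply IHn, class_C_dx, H.
  + apply IHn, class_C_dy, H.
Qed.

(** It suffices to exhibit the partial derivatives on the exterior; the closure
    of the class C^n under products and inverses then follows by induction. *)
Lemma class_C_S_eq n f g1 g2 :
  class_C 0 f ->
  (forall x y, exterior x y -> is_derive (fun s => f s y) x (g1 x y)
                       /\ is_derive (fun s => f x s) y (g2 x y)) ->
  class_C n g1 -> class_C n g2 -> class_C (S n) f.
Proof.
intros H0 Hd H1 H2.
assert (E1 : eqx g1 (dx f)).
{ intros x y Hxy. symmetry. apply is_derive_unique, Hd, Hxy. }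
assert (E2 : eqx g2 (dy f)).
{ intros x y Hxy. symmetry. apply is_derive_unique, Hd, Hxy. }
apply class_C_S; auto.
- intros x y Hxy. rewrite <- E1, <- E2 by assumption. auto.
- apply (class_C_eqx n g1); auto.
- apply (class_C_eqx n g2); auto.
Qed.

Lemma is_derive_constR (c x : R) : is_derive (fun _ : R => c) x 0.
Proof. apply @is_derive_const. Qed.

Lemma is_derive_idR (x : R) : is_derive (fun s : R => s) x 1.
Proof. apply @is_derive_id. Qed.

Lemma is_derive_prod (f g : R -> R) (x a b : R) :
  is_derive f x a -> is_derive g x b ->
  is_derive (fun s => f s * g s) x (a * g x + f x * b).
Proof. intros Hf Hg. apply @is_derive_mult; auto. intros; apply Rmult_comm. Qed.

Lemma class_C_f_const n : forall c, class_C n (f_const c).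
Proof.
induction n; intros c.
- apply class_C_0; intros; apply continuity_2d_pt_const.
- apply (class_C_S_eq n _ (f_const 0) (f_const 0)); auto.
  + apply class_C_0; intros; apply continuity_2d_pt_const.
  + intros x y _; split; [exact (is_derive_constR c x)|exact (is_derive_constR c y)].
Qed.

Lemma class_C_coord_x n : class_C n coord_x.
Proof.
assert (C : class_C 0 coord_x) by (apply class_C_0; intros; apply continuity_2d_pt_id1).
destruct n; [exact C|].
apply (class_C_S_eq n _ (f_const 1) (f_const 0)); auto using class_C_f_const.
intros x y _; split; [exact (is_derive_idR x)|exact (is_derive_constR x y)].
Qed.

Lemma class_C_coord_y n : class_C n coord_y.
Proof.
assert (C : class_C 0 coord_y) by (apply class_C_0; intros; apply continuity_2d_pt_id2).
destruct n; [exact C|].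
apply (class_C_S_eq n _ (f_const 0) (f_const 1)); auto using class_C_f_const.
intros x y _; split; [exact (is_derive_constR y x)|exact (is_derive_idR y)].
Qed.

Lemma class_C_f_add n : forall f g, class_C n f -> class_C n g -> class_C n (f_add f g).
Proof.
assert (C : forall f g, class_C 0 f -> class_C 0 g -> class_C 0 (f_add f g)).
{ intros f g Hf Hg; apply class_C_0; intros x y H.
  apply continuity_2d_pt_plus; eapply class_C_cont; eauto. }
induction n; intros f g Hf Hg; [auto|].
apply (class_C_S_eq n _ (f_add (dx f) (dx g)) (f_add (dy f) (dy g))).
- apply C; apply class_C_0; intros; eapply class_C_cont; eauto.
- intros x y H; split; apply @is_derive_plus;
    first [eapply class_C_is_derive_x; eassumption | eapply class_C_is_derive_y; eassumption].
- apply IHn; apply class_C_dx; auto.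
- apply IHn; apply class_C_dy; auto.
Qed.

Lemma class_C_f_mul n : forall f g, class_C n f -> class_C n g -> class_C n (f_mul f g).
Proof.
assert (C : forall f g, class_C 0 f -> class_C 0 g -> class_C 0 (f_mul f g)).
{ intros f g Hf Hg; apply class_C_0; intros x y H.
  apply continuity_2d_pt_mult; eapply class_C_cont; eauto. }
induction n; intros f g Hf Hg; [auto|].
apply (class_C_S_eq n _ (f_add (f_mul (dx f) g) (f_mul f (dx g)))
                   (f_add (f_mul (dy f) g) (f_mul f (dy g)))).
- apply C; apply class_C_0; intros; eapply class_C_cont; eauto.
- intros x y H; split.
  + apply (is_derive_prod (fun s => f s y) (fun s => g s y)); eapply class_C_is_derive_x;
    eassumption.
  + apply (is_derive_prod (fun s => f x s) (fun s => g x s)); eapply class_C_is_derive_y;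
    eassumption.
- apply class_C_f_add; apply IHn; auto using class_C_down, class_C_dx.
- apply class_C_f_add; apply IHn; auto using class_C_down, class_C_dy.
Qed.

Lemma class_C_f_sub n f g : class_C n f -> class_C n g -> class_C n (f_sub f g).
Proof.
intros Hf Hg. apply (class_C_eqx n (f_add f (f_mul (f_const (-1)) g))).
- intros x y _; unfold f_add, f_mul, f_sub, f_const; ring.
- apply class_C_f_add, class_C_f_mul; auto using class_C_f_const.
Qed.

Lemma class_C_f_inv n : forall f, (forall x y, exterior x y -> f x y <> 0) ->
  class_C n f -> class_C n (f_inv f).
Proof.
intros f Hf.
assert (C : class_C 0 f -> class_C 0 (f_inv f)).
{ intros H; apply class_C_0; intros x y Hxy.
  apply continuity_2d_pt_inv; auto. eapply class_C_cont; eauto. }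
induction n; intros H; [auto|].
apply (class_C_S_eq n _ (f_mul (f_mul (f_const (-1)) (dx f)) (f_mul (f_inv f) (f_inv f)))
                   (f_mul (f_mul (f_const (-1)) (dy f)) (f_mul (f_inv f) (f_inv f)))).
- apply C; apply class_C_0; intros; eapply class_C_cont; eauto.
- intros x y Hxy; split.
  + replace (f_mul _ _ x y) with (- dx f x y / f x y ^ 2).
    * apply (is_derive_inv (fun s => f s y)); [eapply class_C_is_derive_x; eassumption|auto].
    * unfold f_mul, f_inv, f_const; field; auto.
  + replace (f_mul _ _ x y) with (- dy f x y / f x y ^ 2).
    * apply (is_derive_inv (fun s => f x s)); [eapply class_C_is_derive_y; eassumption|auto].
    * unfold f_mul, f_inv, f_const; field; auto.
- repeat apply class_C_f_mul; auto using class_C_f_const, class_C_down, class_C_dx.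
- repeat apply class_C_f_mul; auto using class_C_f_const, class_C_down, class_C_dy.
Qed.

(** C^infinity on the open exterior. *)
Definition smooth (f : scalar_field) : Prop := forall n, class_C n f.

Lemma smooth_of_smooth_ext f : smooth_ext f -> smooth f.
Proof. intros H n x y Hxy; apply H, Hxy. Qed.

Lemma smooth_eqx f g : eqx f g -> smooth f -> smooth g.
Proof. intros E H n; apply (class_C_eqx n f); auto. Qed.
Lemma smooth_f_const c : smooth (f_const c).
Proof. intros n; apply class_C_f_const. Qed.
Lemma smooth_coord_x : smooth coord_x.
Proof. intros n; apply class_C_coord_x. Qed.
Lemma smooth_coord_y : smooth coord_y.
Proof. intros n; apply class_C_coord_y. Qed.
Lemma smooth_f_add f g : smooth f -> smooth g -> smooth (f_add f g).
Proof. intros Hf Hg n; apply class_C_f_add; auto. Qed.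
Lemma smooth_f_sub f g : smooth f -> smooth g -> smooth (f_sub f g).
Proof. intros Hf Hg n; apply class_C_f_sub; auto. Qed.
Lemma smooth_f_mul f g : smooth f -> smooth g -> smooth (f_mul f g).
Proof. intros Hf Hg n; apply class_C_f_mul; auto. Qed.
Lemma smooth_f_inv f : (forall x y, exterior x y -> f x y <> 0) -> smooth f -> smooth (f_inv f).
Proof. intros Hf Hg n; apply class_C_f_inv; auto. Qed.
Lemma smooth_dx f : smooth f -> smooth (dx f).
Proof. intros H n; apply class_C_dx, H. Qed.
Lemma smooth_dy f : smooth f -> smooth (dy f).
Proof. intros H n; apply class_C_dy, H. Qed.

Create HintDb smooth.
#[global] Hint Resolve smooth_f_const smooth_coord_x smooth_coord_y smooth_f_add smooth_f_sub
  smooth_f_mul smooth_dx smooth_dy : smooth.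

Lemma smooth_is_derive_x f x y : smooth f -> exterior x y ->
  is_derive (fun s => f s y) x (dx f x y).
Proof. intros H; apply (class_C_is_derive_x 0), H. Qed.
Lemma smooth_is_derive_y f x y : smooth f -> exterior x y ->
  is_derive (fun s => f x s) y (dy f x y).
Proof. intros H; apply (class_C_is_derive_y 0), H. Qed.
Lemma smooth_continuity_2d f x y : smooth f -> exterior x y -> continuity_2d_pt f x y.
Proof. intros H; apply (class_C_cont 0), H. Qed.

Lemma dx_f_const c x y : dx (f_const c) x y = 0.
Proof. exact (is_derive_unique _ _ _ (is_derive_constR c x)). Qed.
Lemma dy_f_const c x y : dy (f_const c) x y = 0.
Proof. exact (is_derive_unique _ _ _ (is_derive_constR c y)). Qed.
Lemma dx_coord_x x y : dx coord_x x y = 1.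
Proof. exact (is_derive_unique _ _ _ (is_derive_idR x)). Qed.
Lemma dy_coord_x x y : dy coord_x x y = 0.
Proof. exact (is_derive_unique _ _ _ (is_derive_constR x y)). Qed.
Lemma dx_coord_y x y : dx coord_y x y = 0.
Proof. exact (is_derive_unique _ _ _ (is_derive_constR y x)). Qed.
Lemma dy_coord_y x y : dy coord_y x y = 1.
Proof. exact (is_derive_unique _ _ _ (is_derive_idR y)). Qed.

Lemma dx_f_add f g x y (Hf : smooth f) (Hg : smooth g) (H : exterior x y) :
  dx (f_add f g) x y = dx f x y + dx g x y.
Proof. apply is_derive_unique. apply @is_derive_plus; apply smooth_is_derive_x; auto. Qed.
Lemma dy_f_add f g x y (Hf : smooth f) (Hg : smooth g) (H : exterior x y) :
  dy (f_add f g) x y = dy f x y + dy g x y.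
Proof. apply is_derive_unique. apply @is_derive_plus; apply smooth_is_derive_y; auto. Qed.
Lemma dx_f_sub f g x y (Hf : smooth f) (Hg : smooth g) (H : exterior x y) :
  dx (f_sub f g) x y = dx f x y - dx g x y.
Proof. apply is_derive_unique. apply @is_derive_minus; apply smooth_is_derive_x; auto. Qed.
Lemma dy_f_sub f g x y (Hf : smooth f) (Hg : smooth g) (H : exterior x y) :
  dy (f_sub f g) x y = dy f x y - dy g x y.
Proof. apply is_derive_unique. apply @is_derive_minus; apply smooth_is_derive_y; auto. Qed.
Lemma dx_f_mul f g x y (Hf : smooth f) (Hg : smooth g) (H : exterior x y) :
  dx (f_mul f g) x y = dx f x y * g x y + f x y * dx g x y.
Proof.
apply is_derive_unique.
apply (is_derive_prod (fun s => f s y) (fun s => g s y)); apply smooth_is_derive_x; auto.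
Qed.
Lemma dy_f_mul f g x y (Hf : smooth f) (Hg : smooth g) (H : exterior x y) :
  dy (f_mul f g) x y = dy f x y * g x y + f x y * dy g x y.
Proof.
apply is_derive_unique.
apply (is_derive_prod (fun s => f x s) (fun s => g x s)); apply smooth_is_derive_y; auto.
Qed.
Lemma dx_f_inv f x y (Hf : smooth f) (H : exterior x y) :
  f x y <> 0 -> dx (f_inv f) x y = - dx f x y / f x y ^ 2.
Proof.
intros H0. apply is_derive_unique, (is_derive_inv (fun s => f s y)); auto.
apply smooth_is_derive_x; auto.
Qed.
Lemma dy_f_inv f x y (Hf : smooth f) (H : exterior x y) :
  f x y <> 0 -> dy (f_inv f) x y = - dy f x y / f x y ^ 2.
Proof.
intros H0. apply is_derive_unique, (is_derive_inv (fun s => f x s)); auto.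
apply smooth_is_derive_y; auto.
Qed.

Lemma dx_dy f x y (Hf : smooth f) (H : exterior x y) :
  dx (dy f) x y = dy (dx f) x y.
Proof.
apply Schwarz.
- apply exterior_locally_2d; auto. intros u v K. repeat split; eexists.
  + apply (smooth_is_derive_x f); auto.
  + apply (smooth_is_derive_y f); auto.
  + apply (smooth_is_derive_x (dy f)); auto with smooth.
  + apply (smooth_is_derive_y (dx f)); auto with smooth.
- apply (smooth_continuity_2d (dx (dy f))); auto with smooth.
- apply (smooth_continuity_2d (dy (dx f))); auto with smooth.
Qed.

Lemma smooth_differentiable f x y (Hf : smooth f) (H : exterior x y) :

  differentiable_pt_lim f x y (dx f x y) (dy f x y).
Proof.
apply filterdiff_differentiable_pt_lim.
apply (is_derive_filterdiff f x y (dx f) (dy f x y)).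
- apply (locally_2d_locally (fun u v => is_derive (fun z => f z v) u (dx f u v))).
  apply exterior_locally_2d; auto. intros; apply smooth_is_derive_x; auto.
- apply smooth_is_derive_y; auto.
- apply (continuity_2d_pt_filterlim (dx f)), smooth_continuity_2d; auto with smooth.
Qed.

(** * Logarithmic polar coordinates *)

(** The vector fields [x d/dx + y d/dy] and [x d/dy - y d/dx].  In the coordinates
    [x = exp t cos theta], [y = exp t sin theta] they are the derivatives with
    respect to [t] and to [theta]. *)
Definition D_t (h : scalar_field) : scalar_field :=
  f_add (f_mul coord_x (dx h)) (f_mul coord_y (dy h)).
Definition D_theta (h : scalar_field) : scalar_field :=
  f_sub (f_mul coord_x (dy h)) (f_mul coord_y (dx h)).

Lemma smooth_D_t h : smooth h -> smooth (D_t h).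
Proof. unfold D_t; auto with smooth. Qed.
Lemma smooth_D_theta h : smooth h -> smooth (D_theta h).
Proof. unfold D_theta; auto with smooth. Qed.
#[global] Hint Resolve smooth_D_t smooth_D_theta : smooth.

(** The field [h] read in the coordinates [t = ln r] and [theta]; the exterior
    becomes the half-plane [0 < t]. *)
Definition polar (h : scalar_field) : scalar_field :=
  fun t th => h (exp t * cos th) (exp t * sin th).

Lemma polar_sq t th : (exp t * cos th) ^ 2 + (exp t * sin th) ^ 2 = exp t ^ 2.
Proof.
generalize (sin2_cos2 th); unfold Rsqr; intros E.
replace ((exp t * cos th) ^ 2 + (exp t * sin th) ^ 2)
  with (exp t ^ 2 * (sin th * sin th + cos th * cos th)) by ring.
rewrite E; ring.
Qed.

Lemma rad_polar t th : rad (exp t * cos th) (exp t * sin th) = exp t.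
Proof.
unfold rad. rewrite polar_sq. apply sqrt_pow2. left; apply exp_pos.
Qed.

Lemma exterior_polar t th : 0 < t -> exterior (exp t * cos th) (exp t * sin th).
Proof.
intros H; unfold exterior. rewrite rad_polar, <- exp_0. apply exp_increasing, H.
Qed.

Lemma polar_derive_t h t th : smooth h -> 0 < t ->
  is_derive (fun s => polar h s th) t (polar (D_t h) t th).
Proof.
intros Hh Ht. apply is_derive_Reals. unfold polar.
replace (D_t h _ _) with
  (dx h (exp t * cos th) (exp t * sin th) * (exp t * cos th) +
   dy h (exp t * cos th) (exp t * sin th) * (exp t * sin th))
  by (unfold D_t, f_add, f_mul, coord_x, coord_y; ring).
apply (derivable_pt_lim_comp_2d h (fun s => exp s * cos th) (fun s => exp s * sin th)).
- apply smooth_differentiable; auto using exterior_polar.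
- apply is_derive_Reals. auto_derive; auto; ring.
- apply is_derive_Reals. auto_derive; auto; ring.
Qed.

Lemma polar_derive_theta h t th : smooth h -> 0 < t ->
  is_derive (fun s => polar h t s) th (polar (D_theta h) t th).
Proof.
intros Hh Ht. apply is_derive_Reals. unfold polar.
replace (D_theta h _ _) with
  (dx h (exp t * cos th) (exp t * sin th) * (- (exp t * sin th)) +
   dy h (exp t * cos th) (exp t * sin th) * (exp t * cos th))
  by (unfold D_theta, f_sub, f_mul, coord_x, coord_y; ring).
apply (derivable_pt_lim_comp_2d h (fun s => exp t * cos s) (fun s => exp t * sin s)).
- apply smooth_differentiable; auto using exterior_polar.
- apply is_derive_Reals. auto_derive; auto; ring.
- apply is_derive_Reals. auto_derive; auto; ring.
Qed.

Lemma locally_pos t : 0 < t -> locally t (fun s => 0 < s).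
Proof. intros H. apply (open_gt 0 t H). Qed.

Lemma locally_2d_pos (P : R -> R -> Prop) t th :
  (forall s r, 0 < s -> P s r) -> 0 < t -> locally_2d P t th.
Proof.
intros HP Ht. destruct (locally_pos t Ht) as [d Hd].
exists d. intros u v Hu _. apply HP, Hd, Hu.
Qed.

Lemma continuity_2d_partials (h ht : R -> R -> R) t th c :
  0 < t ->
  (forall s r, 0 < s -> is_derive (fun s => h s r) s (ht s r)) ->
  is_derive (fun r => h t r) th c ->
  continuity_2d_pt ht t th ->
  continuity_2d_pt h t th.
Proof.
intros Ht H1 H2 H3.
apply differentiable_continuity_pt. exists (ht t th), c.
apply filterdiff_differentiable_pt_lim.
apply (is_derive_filterdiff h t th ht c); auto.
- apply (locally_2d_locally (fun u v => is_derive (fun z => h z v) u (ht u v))).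
  apply locally_2d_pos; auto.
- apply (continuity_2d_pt_filterlim ht), H3.
Qed.

Lemma polar_continuity_2d h t th : smooth h -> 0 < t -> continuity_2d_pt (polar h) t th.
Proof.
intros Hh Ht.
apply differentiable_continuity_pt.
do 2 eexists.
apply (differentiable_pt_lim_comp h (fun t th => exp t * cos th) (fun t th => exp t * sin th)).
- apply smooth_differentiable; auto using exterior_polar.
- apply filterdiff_differentiable_pt_lim.
  apply (is_derive_filterdiff (fun t th => exp t * cos th) t th (fun t th => exp t * cos th)).
  + apply filter_forall; intros u; auto_derive; auto; ring.
  + auto_derive; auto.
  + apply (continuity_2d_pt_filterlim (fun t th => exp t * cos th)).
    apply continuity_2d_pt_mult.
    * apply (continuity_1d_2d_pt_comp exp (fun t _ => t)); [|apply continuity_2d_pt_id1].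
      apply derivable_continuous_pt, derivable_pt_exp.
    * apply (continuity_1d_2d_pt_comp cos (fun _ t => t)); [|apply continuity_2d_pt_id2].
      apply derivable_continuous_pt, derivable_pt_cos.
- apply filterdiff_differentiable_pt_lim.
  apply (is_derive_filterdiff (fun t th => exp t * sin th) t th (fun t th => exp t * sin th)).
  + apply filter_forall; intros u; auto_derive; auto; ring.
  + auto_derive; auto.
  + apply (continuity_2d_pt_filterlim (fun t th => exp t * sin th)).
    apply continuity_2d_pt_mult.
    * apply (continuity_1d_2d_pt_comp exp (fun t _ => t)); [|apply continuity_2d_pt_id1].
      apply derivable_continuous_pt, derivable_pt_exp.
    * apply (continuity_1d_2d_pt_comp sin (fun _ t => t)); [|apply continuity_2d_pt_id2].
      apply derivable_continuous_pt, derivable_pt_sin.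
Qed.

(** Evaluation of the combinators, used as rewriting rules. *)
Lemma f_addE f g x y : f_add f g x y = f x y + g x y. Proof. reflexivity. Qed.
Lemma f_subE f g x y : f_sub f g x y = f x y - g x y. Proof. reflexivity. Qed.
Lemma f_mulE f g x y : f_mul f g x y = f x y * g x y. Proof. reflexivity. Qed.
Lemma f_constE c x y : f_const c x y = c. Proof. reflexivity. Qed.
Lemma coord_xE x y : coord_x x y = x. Proof. reflexivity. Qed.
Lemma coord_yE x y : coord_y x y = y. Proof. reflexivity. Qed.

(** Expands every derivative of a combination of smooth fields into derivatives of
    the elementary ones. *)
Ltac expand_derivatives :=
  unfold D_t, D_theta;
  repeat first [ rewrite dx_f_add by auto 8 with smooth | rewrite dy_f_add by auto 8 with smooth
    | rewrite dx_f_sub by auto 8 with smooth | rewrite dy_f_sub by auto 8 with smooth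
    | rewrite dx_f_mul by auto 8 with smooth | rewrite dy_f_mul by auto 8 with smooth
    | rewrite dx_f_const | rewrite dy_f_const | rewrite dx_coord_x | rewrite dy_coord_x
    | rewrite dx_coord_y | rewrite dy_coord_y
    | rewrite f_addE | rewrite f_subE | rewrite f_mulE | rewrite f_constE
    | rewrite coord_xE | rewrite coord_yE ].

Lemma D_t_D_theta h x y : smooth h -> exterior x y -> D_t (D_theta h) x y = D_theta (D_t h) x y.
Proof.
intros Hh H. expand_derivatives. rewrite (dx_dy h) by auto. ring.
Qed.

Lemma polar_periodic h t th : polar h t (th + 2 * PI) = polar h t th.
Proof. unfold polar. rewrite cos_plus, sin_plus, cos_2PI, sin_2PI. f_equal; ring. Qed.

(** * Integration over circles *)

(** [h] is continuously differentiable on [0 < t], with partial derivatives [ht]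
    and [hth]. *)
Definition polar_C1 (h ht hth : R -> R -> R) : Prop :=
  forall t th, 0 < t ->
    is_derive (fun s => h s th) t (ht t th) /\
    is_derive (fun s => h t s) th (hth t th) /\
    continuity_2d_pt h t th /\ continuity_2d_pt ht t th /\ continuity_2d_pt hth t th.

Lemma polar_C1_polar h : smooth h -> polar_C1 (polar h) (polar (D_t h)) (polar (D_theta h)).
Proof.
intros Hh t th Ht. split; [|split; [|split; [|split]]].
- apply polar_derive_t; auto.
- apply polar_derive_theta; auto.
- apply polar_continuity_2d; auto.
- apply polar_continuity_2d; auto with smooth.
- apply polar_continuity_2d; auto with smooth.
Qed.

Lemma continuity_2d_slice (h : R -> R -> R) t th : continuity_2d_pt h t th -> continuous (h t) th.
Proof.
intros H. apply continuity_pt_filterlim, continuity_pt_locally.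
intros eps. destruct (H eps) as [d Hd]. exists d. intros y Hy.
apply Hd; [|exact Hy]. rewrite Rminus_diag_eq, Rabs_R0; auto. apply cond_pos.
Qed.

Lemma ex_RInt_slice (h : R -> R -> R) t a b :
  (forall th, continuity_2d_pt h t th) -> ex_RInt (h t) a b.
Proof. intros H. apply (ex_RInt_continuous (h t)). intros z _; apply continuity_2d_slice, H. Qed.

Lemma is_derive_RInt_slice (h ht : R -> R -> R) t a b :
  0 < t ->
  (forall s th, 0 < s -> is_derive (fun s => h s th) s (ht s th)) ->
  (forall s th, 0 < s -> continuity_2d_pt h s th) ->
  (forall s th, 0 < s -> continuity_2d_pt ht s th) ->
  is_derive (fun s => RInt (h s) a b) t (RInt (ht t) a b).
Proof.
intros Ht Hd Hc Hc'.
replace (RInt (ht t) a b) with (RInt (fun th => Derive (fun u => h u th) t) a b).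
- apply is_derive_RInt_param.
  + generalize (locally_pos t Ht); apply filter_imp; intros s Hs th _.
    eexists; apply Hd, Hs.
  + intros th _. apply (continuity_2d_pt_ext_loc ht); [|apply Hc', Ht].
    apply locally_2d_pos; auto. intros s r Hs. symmetry. apply is_derive_unique, Hd, Hs.
  + generalize (locally_pos t Ht); apply filter_imp; intros s Hs.
    apply ex_RInt_slice; auto.
- apply RInt_ext; intros; apply is_derive_unique, Hd, Ht.
Qed.

(** A continuous nonnegative function with nonpositive integral vanishes at every
    interior point. *)
Lemma RInt_nonneg_zero (q : R -> R) c d m :
  (forall s, continuous q s) -> (forall s, 0 <= q s) ->
  RInt q c d <= 0 -> c < m < d -> q m = 0.
Proof.
intros Hc Hq HI Hm.
assert (HE : forall a b, ex_RInt q a b) by (intros; apply (ex_RInt_continuous q); auto).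
assert (Z : forall s, c < s < d -> RInt q c s = 0).
{ intros s Hs.
  assert (A : 0 <= RInt q c s) by (apply RInt_ge_0; auto; lra).
  assert (B : 0 <= RInt q s d) by (apply RInt_ge_0; auto; lra).
  assert (C : RInt q c s + RInt q s d = RInt q c d) by (apply (RInt_Chasles q c s d); auto).
  lra. }
assert (D : is_derive (RInt q c) m (q m)).
{ apply (is_derive_RInt q (RInt q c) c m); auto.
  apply filter_forall; intros; apply (@RInt_correct R_CompleteNormedModule), HE. }
assert (D' : is_derive (RInt q c) m 0).
{ apply (is_derive_ext_loc (fun _ => 0)); [|apply is_derive_constR].
  assert (O : locally m (fun s => c < s /\ s < d)).
  { apply filter_and; [apply (open_gt c m)|apply (open_lt d m)]; lra. }
  revert O; apply filter_imp; intros s Hs; symmetry; apply Z; lra. }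
apply is_derive_unique in D. apply is_derive_unique in D'. congruence.
Qed.

Lemma derive_nonpos_decr (H H' : R -> R) :
  (forall t, 0 < t -> is_derive H t (H' t)) -> (forall t, 0 < t -> H' t <= 0) ->
  forall s t, 0 < s <= t -> H t <= H s.
Proof.
intros Hd Hn s t [Hs Hst].
destruct (MVT_gen H s t H') as [c [Hc E]].
- rewrite Rmin_left, Rmax_right by lra. intros x Hx; apply Hd; lra.
- rewrite Rmin_left, Rmax_right by lra. intros x Hx.
  apply derivable_continuous_pt. exists (H' x). apply is_derive_Reals, Hd; lra.
- rewrite Rmin_left, Rmax_right in Hc by lra.
  assert (H' c <= 0) by (apply Hn; lra). nra.
Qed.

(** A decreasing function that tends to zero both at [0] and at infinity is
    identically zero, hence so is its derivative. *)
Lemma decr_vanishing_ends (H H' : R -> R) beta M : 0 < beta -> 0 <= M ->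
  (forall t, 0 < t -> is_derive H t (H' t)) -> (forall t, 0 < t -> H' t <= 0) ->
  (forall t, 0 < t -> Rabs (H t) <= M * t) ->
  (forall t, 0 < t -> Rabs (H t) <= M * exp (- beta * t)) ->
  forall t, 0 < t -> H' t = 0.
Proof.
intros Hb HM Hd Hn H0 Hoo.
assert (Z : forall t, 0 < t -> H t = 0).
{ intros t Ht.
  assert (M1 := derive_nonpos_decr H H' Hd Hn).
  apply Rle_antisym; apply Rnot_lt_le; intros K.
  (* H t > 0 would bound H from below near 0, against H s <= M s *)
  - set (s := Rmin t (H t / (2 * (M + 1)))).
    assert (Hs : 0 < s) by (apply Rmin_pos; [lra|apply Rdiv_lt_0_compat; lra]).
    assert (s <= t) by apply Rmin_l.
    assert (Hs2 : s <= H t / (2 * (M + 1))) by apply Rmin_r.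
    assert (s * (2 * (M + 1)) <= H t).
    { apply Rmult_le_reg_r with (/ (2 * (M + 1))); [apply Rinv_0_lt_compat; lra|].
      rewrite Rmult_assoc, Rinv_r by lra. lra. }
    assert (H t <= H s) by (apply M1; lra).
    generalize (H0 s Hs) (Rle_abs (H s)). nra.
  (* H t < 0 would bound H from above near infinity; exponential decay enters only
     through exp (- beta s) * (beta s) <= 1 *)
  - set (s := t + 2 * (M + 1) / (beta * (- H t))).
    assert (P : 0 < 2 * (M + 1) / (beta * (- H t))).
    { apply Rdiv_lt_0_compat; [lra|]. apply Rmult_lt_0_compat; lra. }
    assert (H s <= H t) by (apply M1; unfold s; lra).
    assert (Hs : 0 < s) by (unfold s; lra).
    assert (E1 : beta * s * (- H t) >= 2 * (M + 1)).
    { unfold s. replace (beta * (t + 2 * (M + 1) / (beta * - H t)) * - H t)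
        with (beta * t * (- H t) + 2 * (M + 1)) by (field; lra).
      assert (0 <= beta * t * (- H t)) by (repeat apply Rmult_le_pos; lra). lra. }
    assert (E2 : exp (- beta * s) * (beta * s) <= 1).
    { replace (- beta * s) with (- (beta * s)) by ring. rewrite exp_Ropp.
      assert (1 + beta * s <= exp (beta * s)) by (apply exp_ineq1_le).
      assert (0 < exp (beta * s)) by apply exp_pos.
      apply Rmult_le_reg_l with (exp (beta * s)); auto.
      rewrite <- Rmult_assoc, Rinv_r by lra. lra. }
    assert (E3 := Hoo s Hs). assert (E4 := Rle_abs (- H s)). rewrite Rabs_Ropp in E4.
    assert (E5 : - H t <= M * exp (- beta * s)) by lra.
    assert (E6 := exp_pos (- beta * s)).
    assert (Q : 0 < beta * s) by (apply Rmult_lt_0_compat; lra).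
    assert (beta * s * (- H t) <= beta * s * (M * exp (- beta * s)))
      by (apply Rmult_le_compat_l; lra).
    nra. }
intros t Ht.
assert (D := is_derive_unique _ _ _ (Hd t Ht)). rewrite <- D.
rewrite (Derive_ext_loc H (fun _ => 0)); [apply Derive_const|].
generalize (locally_pos t Ht); apply filter_imp; intros; apply Z; auto.
Qed.

(** * The energy density *)

(** The functions [Q] and [S] of the introduction, as quadratic forms in the values of
    the fields; minus the divergence of [(Q, S)] is the energy density.  The term
    [kap E psi^2] in [flux_t], with [E = exp (- beta t)], provides a Hardy inequality
    for the stream function. *)
Definition flux_t (k mu kap E a z g f psi : R) : R :=
  psi * a - z * g - 2 * z * psi - (k - 2) / 2 * (g * g - f * f) - 2 * k * (g * psi)
  - mu * (g * f) + kap * (E * (psi * psi)).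

Definition flux_theta (k mu b z g f psi : R) : R :=
  - psi * b + z * f + (k - 2) * (g * f) + 2 * k * (f * psi) + mu / 2 * (f * f - g * g).

(** The derivatives of [flux_t] in [t] and of [flux_theta] in [theta], when [psi_t = g]
    and [psi_theta = - f]; primes denote the derivatives of the other arguments. *)
Definition dflux_t (k mu kap beta E a a' z z' g g' f f' psi : R) : R :=
  g * a + psi * a' - (z' * g + z * g') - 2 * (z' * psi + z * g)
  - (k - 2) * (g * g' - f * f') - 2 * k * (g' * psi + g * g)
  - mu * (g' * f + g * f') + kap * (- beta * E * (psi * psi) + E * (2 * g * psi)).

Definition dflux_theta (k mu b b' z z' g g' f f' psi : R) : R :=
  f * b - psi * b' + (z' * f + z * f') + (k - 2) * (g' * f + g * f')
  + 2 * k * (f' * psi - f * f) + mu * (f * f' - g * g').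

Lemma flux_t_derive k mu kap beta (a z g f psi : R -> R) (t a' z' g' f' : R) :
  is_derive a t a' -> is_derive z t z' -> is_derive g t g' -> is_derive f t f' ->
  is_derive psi t (g t) ->
  is_derive (fun s => flux_t k mu kap (exp (- beta * s)) (a s) (z s) (g s) (f s) (psi s)) t
    (dflux_t k mu kap beta (exp (- beta * t)) (a t) a' (z t) z' (g t) g' (f t) f' (psi t)).
Proof.
intros Ha Hz Hg Hf Hp. unfold flux_t. auto_derive.
- repeat split; eexists; eassumption.
- rewrite (is_derive_unique (fun s : R => a s) _ _ Ha), (is_derive_unique (fun s : R => z s) _ _ Hz),
    (is_derive_unique (fun s : R => g s) _ _ Hg),
    (is_derive_unique (fun s : R => f s) _ _ Hf), (is_derive_unique (fun s : R => psi s) _ _ Hp).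
  unfold dflux_t. field.
Qed.

Lemma flux_theta_derive k mu (b z g f psi : R -> R) (t b' z' g' f' : R) :
  is_derive b t b' -> is_derive z t z' -> is_derive g t g' -> is_derive f t f' ->
  is_derive psi t (- f t) ->
  is_derive (fun s => flux_theta k mu (b s) (z s) (g s) (f s) (psi s)) t
    (dflux_theta k mu (b t) b' (z t) z' (g t) g' (f t) f' (psi t)).
Proof.
intros Ha Hz Hg Hf Hp. unfold flux_theta. auto_derive.
- repeat split; eexists; eassumption.
- rewrite (is_derive_unique (fun s : R => b s) _ _ Ha), (is_derive_unique (fun s : R => z s) _ _ Hz),
    (is_derive_unique (fun s : R => g s) _ _ Hg),
    (is_derive_unique (fun s : R => f s) _ _ Hf), (is_derive_unique (fun s : R => psi s) _ _ Hp).
  unfold dflux_theta. field.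
Qed.

(** The energy identity in divergence form.  Apart from the contribution of [kap], all
    terms without a sign and without one of the small coefficients [FV], [GV], [Om]
    cancel, including those proportional to [mu].  The derivative [f_t] is written as
    [- gth]. *)
Lemma density_identity k mu kap beta E FV GV Om a a' b b' z zt zth g gt gth f fth psi :
  gt - fth = z -> a' - b' = 2 * a ->
  a = zt + k * z - FV * z - f * Om ->
  b = - zth + (mu + GV) * z + g * Om ->
  dflux_t k mu kap beta E a a' z zt g gt f (- gth) psi
  + dflux_theta k mu b b' z zth g gth f fth psi
  = - z ^ 2 - 2 * k * (g ^ 2 + f ^ 2) - kap * beta * E * psi ^ 2 + 2 * kap * E * psi * g
    + GV * z * f - FV * z * (g + 2 * psi) - 2 * f * Om * psi.
Proof.
intros E1 E2 E3 E4.
replace a' with (b' + 2 * a) by lra. replace fth with (gt - z) by lra.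
rewrite E4, E3. unfold dflux_t, dflux_theta. field.
Qed.

Lemma prod_bound p q c d : Rabs p <= c -> Rabs q <= d -> Rabs (p * q) <= c * d.
Proof.
intros H1 H2. rewrite Rabs_mult. apply Rmult_le_compat; auto using Rabs_pos.
Qed.

(** For small coefficients the energy density is coercive: the terms in [psi] are
    absorbed by the Hardy term, which has the same exponential weight.  After Young's
    inequality the perturbation contributes at most [2 eps] to the coefficient of
    [z^2], [5 eps / 2] to that of [f^2] and [3 eps] to that of [E psi^2]; these are to
    be compared with [1], [k / 2] and [k beta^2 / 8]. *)
Lemma density_bound k beta eps E FV GV Om z g f psi :
  0 < k -> 0 < beta -> 0 < eps -> eps <= 1 / 2 -> 5 * eps <= k -> 24 * eps <= k * beta ^ 2 ->
  0 < E <= 1 -> Rabs FV <= eps * E -> Rabs GV <= eps * E -> Rabs Om <= 2 * eps * E ->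
  - z ^ 2 - 2 * k * (g ^ 2 + f ^ 2) - k * beta / 4 * beta * E * psi ^ 2
    + 2 * (k * beta / 4) * E * psi * g
    + GV * z * f - FV * z * (g + 2 * psi) - 2 * f * Om * psi
  <= - k * (g ^ 2 + f ^ 2).
Proof.
intros Hk Hb He He1 He2 He3 HE HF HG HO.
assert (Y : forall v c p q, Rabs v <= c * E -> v * p * q <= c * E * (p ^ 2 + q ^ 2) / 2).
{ intros v c p q Hv.
  assert (Rabs (p * q) <= (p ^ 2 + q ^ 2) / 2).
  { apply Rabs_le. generalize (pow2_ge_0 (p + q)) (pow2_ge_0 (p - q)). intros; split; lra. }
  assert (Rabs (v * (p * q)) <= c * E * ((p ^ 2 + q ^ 2) / 2)) by (apply prod_bound; auto).
  generalize (Rle_abs (v * (p * q))). intros. lra. }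
assert (Y1 := Y GV eps z f HG).
assert (HF' : Rabs (- FV) <= eps * E) by (rewrite Rabs_Ropp; auto).
assert (Y2 := Y (- FV) eps z g HF').
assert (Y3 := Y (- FV) eps z psi HF').
assert (HO' : Rabs (- Om) <= 2 * eps * E) by (rewrite Rabs_Ropp; auto).
assert (Y4 := Y (- Om) (2 * eps) f psi HO').
(* 2 (beta/2 psi) g <= (beta/2 psi)^2 + g^2, times E k / 2 *)
assert (Y5 : 2 * (k * beta / 4) * E * psi * g <= E * (k * (beta ^ 2 / 8 * psi ^ 2 + g ^ 2 / 2))).
{ assert (0 <= (beta / 2 * psi - g) ^ 2) by apply pow2_ge_0.
  assert (0 <= E * k) by (apply Rmult_le_pos; lra).
  assert (0 <= E * k * ((beta / 2 * psi - g) ^ 2)) by (apply Rmult_le_pos; auto).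
  nra. }
assert (Eg : E * g ^ 2 <= g ^ 2) by (assert (0 <= g ^ 2) by apply pow2_ge_0; nra).
assert (Ef : E * f ^ 2 <= f ^ 2) by (assert (0 <= f ^ 2) by apply pow2_ge_0; nra).
assert (Ez : E * z ^ 2 <= z ^ 2) by (assert (0 <= z ^ 2) by apply pow2_ge_0; nra).
assert (P : 0 <= E * psi ^ 2) by (apply Rmult_le_pos; [lra|apply pow2_ge_0]).
assert (Pg := pow2_ge_0 g). assert (Pf := pow2_ge_0 f). assert (Pz := pow2_ge_0 z).
assert (W : forall d p q, eps <= d -> 0 <= p <= q -> eps * p <= d * q).
{ intros; apply Rmult_le_compat; lra. }
assert (0 <= E * g ^ 2) by (apply Rmult_le_pos; lra).
assert (0 <= E * f ^ 2) by (apply Rmult_le_pos; lra).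
assert (0 <= E * z ^ 2) by (apply Rmult_le_pos; lra).
assert (Z1 := W (1 / 2) (E * z ^ 2) (z ^ 2) ltac:(lra) ltac:(lra)).
assert (Z2 := W (k / 5) (E * g ^ 2) (g ^ 2) ltac:(lra) ltac:(lra)).
assert (Z3 := W (k / 5) (E * f ^ 2) (f ^ 2) ltac:(lra) ltac:(lra)).
assert (Z4 := W (k * beta ^ 2 / 24) (E * psi ^ 2) (E * psi ^ 2) ltac:(lra) ltac:(lra)).
assert (Z5 : k * (E * g ^ 2) <= k * g ^ 2) by (apply Rmult_le_compat_l; lra).
assert (0 <= k * g ^ 2) by (apply Rmult_le_pos; lra).
assert (0 <= k * f ^ 2) by (apply Rmult_le_pos; lra).
lra.
Qed.

(** * Uniqueness for the system in polar form *)

Lemma continuity_2d_exp c t th : continuity_2d_pt (fun t _ => exp (c * t)) t th.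
Proof.
apply (continuity_1d_2d_pt_comp exp (fun t _ => c * t)).
- apply derivable_continuous_pt, derivable_pt_exp.
- apply continuity_2d_pt_mult; [apply continuity_2d_pt_const|apply continuity_2d_pt_id1].
Qed.

Ltac continuity_2d := repeat first [ assumption | apply continuity_2d_exp | apply continuity_2d_pt_const
  | apply continuity_2d_pt_plus | apply continuity_2d_pt_minus
  | apply continuity_2d_pt_mult | apply continuity_2d_pt_opp ].

(** The flux is quadratic, so it is small as soon as one factor of each product is:
    this applies with [X = t] near the circle, where [g], [f] and [psi] vanish, and
    with [X = E] at infinity, where everything but [psi] decays. *)
Lemma flux_t_bound k mu kap E C X a z g f psi :
  0 <= C -> 0 <= E <= 1 -> 0 <= X ->
  Rabs g <= C * X -> Rabs f <= C * X -> Rabs g <= C -> Rabs f <= C ->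
  Rabs a <= C -> Rabs z <= C -> Rabs psi <= C ->
  (E <= X /\ Rabs a <= C * X /\ Rabs z <= C * X) \/ Rabs psi <= C * X ->
  Rabs (flux_t k mu kap E a z g f psi) <=
    C * C * (4 + Rabs (k - 2) + Rabs (2 * k) + Rabs mu + Rabs kap) * X.
Proof.
intros HC HE HX Hg Hf Hg' Hf' Ha Hz Hp Hor.
assert (B1 : Rabs (psi * a) <= C * C * X).
{ destruct Hor as [[_ [K _]]|K].
  - generalize (prod_bound _ _ _ _ Hp K); intros; lra.
  - generalize (prod_bound _ _ _ _ K Ha); intros; lra. }
assert (B2 : Rabs (z * g) <= C * C * X) by
  (generalize (prod_bound _ _ _ _ Hz Hg); intros; lra).
assert (B3 : Rabs (z * psi) <= C * C * X).
{ destruct Hor as [[_ [_ K]]|K].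
  - generalize (prod_bound _ _ _ _ K Hp); intros; lra.
  - generalize (prod_bound _ _ _ _ Hz K); intros; lra. }
assert (B4 : Rabs (g * g) <= C * C * X) by
  (generalize (prod_bound _ _ _ _ Hg' Hg); intros; lra).
assert (B5 : Rabs (f * f) <= C * C * X) by
  (generalize (prod_bound _ _ _ _ Hf' Hf); intros; lra).
assert (B6 : Rabs (g * psi) <= C * C * X) by
  (generalize (prod_bound _ _ _ _ Hg Hp); intros; lra).
assert (B7 : Rabs (g * f) <= C * C * X) by
  (generalize (prod_bound _ _ _ _ Hg' Hf); intros; lra).
assert (B8 : Rabs (E * (psi * psi)) <= C * C * X).
{ assert (HE' : Rabs E <= 1) by (rewrite Rabs_pos_eq; lra).
  destruct Hor as [[K _]|K].
  - assert (K' : Rabs E <= X) by (rewrite Rabs_pos_eq; lra).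
    generalize (prod_bound _ _ _ _ K' (prod_bound _ _ _ _ Hp Hp)); intros; lra.
  - generalize (prod_bound _ _ _ _ HE' (prod_bound _ _ _ _ Hp K)); intros; lra. }
set (M := C * C * X) in *.
assert (D : forall c p, Rabs p <= M -> Rabs (c * p) <= Rabs c * M).
{ intros c p K. apply prod_bound; auto. lra. }
assert (B4' : Rabs (g * g - f * f) <= 2 * M).
{ apply Rabs_le_between in B4. apply Rabs_le_between in B5. apply Rabs_le; lra. }
assert (B4'' : Rabs ((k - 2) / 2 * (g * g - f * f)) <= Rabs (k - 2) * M).
{ replace ((k - 2) / 2 * (g * g - f * f)) with ((k - 2) * ((g * g - f * f) / 2)) by field.
  apply D. apply Rabs_le_between in B4'. apply Rabs_le; lra. }
assert (B6' := D (2 * k) _ B6). assert (B7' := D mu _ B7). assert (B8' := D kap _ B8).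
unfold flux_t.
replace (C * C * (4 + Rabs (k - 2) + Rabs (2 * k) + Rabs mu + Rabs kap) * X)
  with ((4 + Rabs (k - 2) + Rabs (2 * k) + Rabs mu + Rabs kap) * M) by (unfold M; ring).
apply Rabs_le_between in B1. apply Rabs_le_between in B2. apply Rabs_le_between in B3.
apply Rabs_le_between in B4''. apply Rabs_le_between in B6'. apply Rabs_le_between in B7'.
apply Rabs_le_between in B8'.
apply Rabs_le; lra.
Qed.

(** The system satisfied by the difference of two solutions has only the trivial
    solution.  Here [g] and [f] stand for [r w_theta] and [r w_r], [z] for
    [r^2 curl w], [psi] for the stream function, and [a], [b] for [r^2] times the
    [theta]- and [t]-derivatives of the difference of the head pressures.  Only the
    coefficients [FV], [GV], [Om] have to be small; [C] is arbitrary. *)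
Lemma polar_system_unique k beta eps mu C
  (a at_ ath b bt bth z zt zth g gt gth f fth psi FV GV Om : R -> R -> R) :
  0 < k -> 0 < beta -> 0 < eps -> eps <= 1 / 2 -> 5 * eps <= k -> 24 * eps <= k * beta ^ 2 ->
  0 <= C ->
  polar_C1 a at_ ath -> polar_C1 b bt bth -> polar_C1 z zt zth ->
  polar_C1 g gt gth -> polar_C1 f (fun t th => - gth t th) fth ->
  polar_C1 psi g (fun t th => - f t th) ->
  (forall t th, 0 < t ->
     gt t th - fth t th = z t th /\ at_ t th - bth t th = 2 * a t th /\
     a t th = zt t th + k * z t th - FV t th * z t th - f t th * Om t th /\
     b t th = - zth t th + (mu + GV t th) * z t th + g t th * Om t th) ->
  (forall t th, 0 < t ->
     b t (th + 2 * PI) = b t th /\ z t (th + 2 * PI) = z t th /\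
     g t (th + 2 * PI) = g t th /\ f t (th + 2 * PI) = f t th /\
     psi t (th + 2 * PI) = psi t th) ->
  (forall t th, 0 < t ->
     Rabs (FV t th) <= eps * exp (- beta * t) /\
     Rabs (GV t th) <= eps * exp (- beta * t) /\
     Rabs (Om t th) <= 2 * eps * exp (- beta * t)) ->
  (forall t th, 0 < t ->
     Rabs (g t th) <= C * exp (- beta * t) /\ Rabs (f t th) <= C * exp (- beta * t) /\
     Rabs (z t th) <= C * exp (- beta * t) /\ Rabs (a t th) <= C * exp (- beta * t) /\
     Rabs (psi t th) <= C /\
     Rabs (g t th) <= C * t /\ Rabs (f t th) <= C * t /\ Rabs (psi t th) <= C * t) ->
  forall t th, 0 < t -> g t th = 0 /\ f t th = 0.
Proof.
intros Hk Hb He He1 He2 He3 HC Ca Cb Cz Cg Cf Cp Hrel Hper Hsm Hbd t0 th0 Ht0.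
set (kap := k * beta / 4).
(* a full period centred at th0, so that th0 is an interior point *)
set (c := th0 - PI). set (d := th0 + PI).
assert (Hcd : c < th0 < d) by (generalize PI_RGT_0; unfold c, d; lra).
set (Q := fun t th => flux_t k mu kap (exp (- beta * t)) (a t th) (z t th) (g t th) (f t th) (psi t th)).
set (dQ := fun t th => dflux_t k mu kap beta (exp (- beta * t)) (a t th) (at_ t th) (z t th)
   (zt t th) (g t th) (gt t th) (f t th) (- gth t th) (psi t th)).
set (S := fun t th => flux_theta k mu (b t th) (z t th) (g t th) (f t th) (psi t th)).
set (dS := fun t th => dflux_theta k mu (b t th) (bth t th) (z t th)
   (zth t th) (g t th) (gth t th) (f t th) (fth t th) (psi t th)).
set (N := fun t th => g t th ^ 2 + f t th ^ 2).
assert (HE : forall t, 0 < t -> 0 < exp (- beta * t) <= 1).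
{ intros t Ht. split; [apply exp_pos|].
  rewrite <- exp_0. destruct (Rle_lt_or_eq_dec 0 (beta * t)) as [K|K].
  - apply Rmult_le_pos; lra.
  - left; apply exp_increasing; lra.
  - right; f_equal; lra. }
assert (Qd : forall t th, 0 < t -> is_derive (fun s => Q s th) t (dQ t th)).
{ intros t th Ht. unfold Q, dQ.
  apply (flux_t_derive k mu kap beta (fun s => a s th) (fun s => z s th) (fun s => g s th)
    (fun s => f s th) (fun s => psi s th)).
  - apply (Ca t th Ht).
  - apply (Cz t th Ht).
  - apply (Cg t th Ht).
  - apply (Cf t th Ht).
  - apply (Cp t th Ht). }
assert (Sd : forall t th, 0 < t -> is_derive (fun s => S t s) th (dS t th)).
{ intros t th Ht. unfold S, dS.
  apply (flux_theta_derive k mu (b t) (z t) (g t) (f t) (psi t)).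
  - apply (Cb t th Ht).
  - apply (Cz t th Ht).
  - apply (Cg t th Ht).
  - apply (Cf t th Ht).
  - apply (Cp t th Ht). }
assert (Hcont : forall t th, 0 < t -> continuity_2d_pt Q t th /\ continuity_2d_pt dQ t th /\
   continuity_2d_pt dS t th /\ continuity_2d_pt N t th).
{ intros t th Ht.
  destruct (Ca t th Ht) as (_ & _ & Ca1 & Ca2 & Ca3).
  destruct (Cb t th Ht) as (_ & _ & Cb1 & Cb2 & Cb3).
  destruct (Cz t th Ht) as (_ & _ & Cz1 & Cz2 & Cz3).
  destruct (Cg t th Ht) as (_ & _ & Cg1 & Cg2 & Cg3).
  destruct (Cf t th Ht) as (_ & _ & Cf1 & Cf2 & Cf3).
  destruct (Cp t th Ht) as (_ & _ & Cp1 & Cp2 & Cp3).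
  unfold Q, dQ, dS, N, flux_t, dflux_t, dflux_theta; simpl pow.
  split; [|split; [|split]]; continuity_2d. }
assert (Hdens : forall t th, 0 < t -> dQ t th + dS t th <= - k * N t th).
{ intros t th Ht. destruct (Hrel t th Ht) as (R1 & R2 & R3 & R4).
  destruct (Hsm t th Ht) as (S1 & S2 & S3).
  unfold dQ, dS, N.
  rewrite (density_identity k mu kap beta _ (FV t th) (GV t th) (Om t th)); auto.
  apply (density_bound k beta eps); auto. }
set (H := fun t => RInt (Q t) c d : R).
set (H' := fun t => RInt (dQ t) c d : R).
assert (HH : forall t, 0 < t -> is_derive H t (H' t)).
{ intros t Ht. apply is_derive_RInt_slice; auto; intros; apply Hcont; auto. }
assert (HQi : forall t, 0 < t -> ex_RInt (Q t) c d).
{ intros; apply ex_RInt_slice; intros; apply Hcont; auto. }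
assert (HdQi : forall t, 0 < t -> ex_RInt (dQ t) c d).
{ intros; apply ex_RInt_slice; intros; apply Hcont; auto. }
assert (HdSi : forall t, 0 < t -> ex_RInt (dS t) c d).
{ intros; apply ex_RInt_slice; intros; apply Hcont; auto. }
assert (HNi : forall t, 0 < t -> ex_RInt (N t) c d).
{ intros; apply ex_RInt_slice; intros; apply Hcont; auto. }
(* the angular flux drops out by periodicity *)
assert (HS0 : forall t, 0 < t -> RInt (dS t) c d = 0).
{ intros t Ht.
  assert (I : is_RInt (dS t) c d (minus (S t d) (S t c))).
  { apply (is_RInt_derive (S t) (dS t)).
    - intros; apply Sd; auto.
    - intros; apply continuity_2d_slice, Hcont; auto. }
  rewrite (is_RInt_unique _ _ _ _ I).
  replace d with (c + 2 * PI) by (unfold c, d; ring).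
  unfold S. destruct (Hper t c Ht) as (-> & -> & -> & -> & ->).
  apply Rminus_diag_eq; reflexivity. }
assert (HN : forall t, 0 < t -> H' t <= - k * RInt (N t) c d).
{ intros t Ht. unfold H'.
  replace (RInt (dQ t) c d) with (RInt (fun th => dQ t th + dS t th) c d).
  - replace (- k * RInt (N t) c d) with (RInt (fun th => - k * N t th) c d).
    + apply RInt_le; auto; try lra.
      * apply (ex_RInt_plus (V := R_NormedModule)); auto.
      * apply (ex_RInt_scal (V := R_NormedModule) (N t) c d (- k)); auto.
    + apply (RInt_scal (V := R_CompleteNormedModule) (N t) c d (- k)); auto.
  - rewrite (RInt_plus (V := R_CompleteNormedModule) (dQ t) (dS t)); auto.
    rewrite HS0 by auto. apply (plus_zero_r (G := R_AbelianMonoid)). }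
assert (HNpos : forall t, 0 < t -> 0 <= RInt (N t) c d).
{ intros t Ht. apply RInt_ge_0; auto; [lra|]. intros x _. unfold N.
  generalize (pow2_ge_0 (g t x)) (pow2_ge_0 (f t x)); lra. }
set (M := C * C * (4 + Rabs (k - 2) + Rabs (2 * k) + Rabs mu + Rabs kap)).
assert (HM : 0 <= M).
{ unfold M. apply Rmult_le_pos; [apply Rmult_le_pos; auto|].
  generalize (Rabs_pos (k - 2)) (Rabs_pos (2 * k)) (Rabs_pos mu) (Rabs_pos kap); lra. }
assert (HX : forall t th X, 0 < t -> X = t \/ X = exp (- beta * t) -> Rabs (Q t th) <= M * X).
{ intros t th X Ht HX.
  destruct (Hbd t th Ht) as (B1 & B2 & B3 & B4 & B5 & B6 & B7 & B8).
  assert (L : C * exp (- beta * t) <= C) by (generalize (HE t Ht); intros; nra).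
  assert (HEt := HE t Ht).
  apply flux_t_bound; auto; try lra; destruct HX as [-> | ->]; auto; try lra. }
assert (Z : forall t, 0 < t -> H' t = 0).
{ apply (decr_vanishing_ends H H' beta ((d - c) * M)); auto.
  - apply Rmult_le_pos; lra.
  - intros t Ht. assert (k * RInt (N t) c d >= 0).
    { apply Rle_ge, Rmult_le_pos; auto; lra. }
    generalize (HN t Ht); lra.
  - intros t Ht. unfold H. rewrite Rmult_assoc. apply abs_RInt_le_const; auto; try lra.
  - intros t Ht. unfold H. rewrite Rmult_assoc. apply abs_RInt_le_const; auto; try lra. }
assert (N0 : N t0 th0 = 0).
{ apply (RInt_nonneg_zero (N t0) c d); auto.
  - intros s; apply continuity_2d_slice, Hcont; auto.
  - intros s. unfold N. generalize (pow2_ge_0 (g t0 s)) (pow2_ge_0 (f t0 s)); lra.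
  - generalize (HN t0 Ht0). rewrite Z by auto. intros. nra. }
unfold N in N0. split; nra.
Qed.

(** * The stream function *)

(** Bounded derivative and limit zero at [0] give at most linear growth. *)
Lemma linear_bound (h h' : R -> R) C :
  (forall t, 0 < t -> is_derive h t (h' t)) -> (forall t, 0 < t -> Rabs (h' t) <= C) ->
  (forall e, 0 < e -> exists d, 0 < d /\ forall s, 0 < s < d -> Rabs (h s) < e) ->
  forall t, 0 < t -> Rabs (h t) <= C * t.
Proof.
intros Hd Hb H0 t Ht.
assert (HC : 0 <= C) by (generalize (Hb t Ht) (Rabs_pos (h' t)); lra).
apply le_epsilon. intros e He.
destruct (H0 e He) as [d [Hd0 K]].
set (s := Rmin t (d / 2)).
assert (0 < s) by (apply Rmin_pos; lra).
assert (s <= t) by apply Rmin_l.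
assert (s <= d / 2) by apply Rmin_r.
assert (Ks : Rabs (h s) < e) by (apply K; lra).
destruct (MVT_gen h s t h') as [c [Hc E]].
- rewrite Rmin_left, Rmax_right by lra. intros x Hx; apply Hd; lra.
- rewrite Rmin_left, Rmax_right by lra. intros x Hx.
  apply derivable_continuous_pt. exists (h' x). apply is_derive_Reals, Hd; lra.
- rewrite Rmin_left, Rmax_right in Hc by lra.
  assert (B : Rabs (h t - h s) <= C * t).
  { rewrite E. apply prod_bound; [apply Hb; lra|]. rewrite Rabs_pos_eq; lra. }
  replace (h t) with ((h t - h s) + h s) by ring.
  generalize (Rabs_triang (h t - h s) (h s)). lra.
Qed.

(** Extension by zero to [t <= 0]; it is continuous when [g] vanishes at [t = 0]. *)
Definition extend0 (g : R -> R -> R) (t th : R) : R :=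
  if Rle_dec t 0 then 0 else g t th.

Lemma extend0_pos g t th : 0 < t -> extend0 g t th = g t th.
Proof. intros H; unfold extend0. destruct (Rle_dec t 0); auto; lra. Qed.

(** The stream function, obtained by integrating [g = r w_theta] along rays from the
    circle, so that it vanishes there. *)
Definition stream (g : R -> R -> R) (t th : R) : R := RInt (fun s => extend0 g s th) 0 t.

Lemma extend0_continuous g C th :
  (forall t, 0 < t -> continuity_2d_pt g t th) ->
  (forall t, 0 < t -> Rabs (g t th) <= C * t) ->
  0 <= C ->
  forall t, continuous (fun s => extend0 g s th) t.
Proof.
intros Hc Hb HC t. apply continuity_pt_filterlim, continuity_pt_locally. intros e.
destruct (Rlt_le_dec 0 t) as [Ht|Ht].
- destruct (Hc t Ht e) as [d Hd].
  assert (O : locally t (fun s => 0 < s /\ Rabs (s - t) < d)).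
  { apply filter_and; [apply locally_pos, Ht|]. exists d; intros y Hy; exact Hy. }
  revert O; apply filter_imp; intros s [Hs Hs'].
  rewrite !extend0_pos by auto. apply Hd; auto.
  rewrite Rminus_diag_eq, Rabs_R0 by auto; apply cond_pos.
- assert (P : 0 < e / (C + 1)) by (apply Rdiv_lt_0_compat; [apply cond_pos|lra]).
  exists (mkposreal (e / (C + 1)) P).
  intros s Hs. change (Rabs (s - t) < e / (C + 1)) in Hs.
  unfold extend0 at 2. destruct (Rle_dec t 0); [|lra].
  rewrite Rminus_0_r. unfold extend0. destruct (Rle_dec s 0) as [K|K].
  + rewrite Rabs_R0; apply cond_pos.
  + apply Rle_lt_trans with (C * s); [apply Hb; lra|].
    assert (S1 : s < e / (C + 1)) by (generalize (Rle_abs (s - t)); lra).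
    apply Rle_lt_trans with ((C + 1) * s); [nra|].
    apply Rmult_lt_reg_r with (/ (C + 1)); [apply Rinv_0_lt_compat; lra|].
    field_simplify; lra.
Qed.

(** [stream g] has partial derivatives [g] and [- f].  Its angular derivative is
    obtained without differentiating under the integral down to [t = 0]: the flux of
    the field through an arc of radius [exp t] and the two rays joining it to the
    circle does not depend on [t], and tends to zero with [t]. *)
Lemma stream_spec (g gt gth f fth : R -> R -> R) beta C :
  0 < beta -> 0 <= C ->
  polar_C1 g gt gth -> polar_C1 f (fun t th => - gth t th) fth ->
  (forall t th, 0 < t -> g t (th + 2 * PI) = g t th) ->
  (forall t th, 0 < t -> Rabs (g t th) <= C * exp (- beta * t)
    /\ Rabs (g t th) <= C * t /\ Rabs (f t th) <= C * t) ->
  polar_C1 (stream g) g (fun t th => - f t th) /\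
  (forall t th, 0 < t -> stream g t (th + 2 * PI) = stream g t th) /\
  (forall t th, 0 < t -> Rabs (stream g t th) <= C * t /\ Rabs (stream g t th) <= C / beta).
Proof.
intros Hb HC Cg Cf Hper Hbd.
assert (HE : forall t, 0 < t -> exp (- beta * t) <= 1).
{ intros t Ht. rewrite <- exp_0. left; apply exp_increasing. nra. }
assert (Hc : forall th t, continuous (fun s => extend0 g s th) t).
{ intros th. apply (extend0_continuous g C th); auto; intros t Ht; [apply Cg, Ht|apply Hbd, Ht]. }
assert (Hi : forall th a b, ex_RInt (fun s => extend0 g s th) a b).
{ intros. apply (ex_RInt_continuous (fun s => extend0 g s th)). auto. }
assert (Hd : forall t th, 0 < t -> is_derive (fun s => stream g s th) t (g t th)).
{ intros t th Ht. rewrite <- (extend0_pos g t th) by auto.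
  apply (is_derive_RInt (fun s => extend0 g s th) (fun s => stream g s th) 0 t); auto.
  apply filter_forall; intros; apply (@RInt_correct R_CompleteNormedModule), Hi. }
assert (B1 : forall t th, 0 < t -> Rabs (stream g t th) <= C * t).
{ intros t th Ht. unfold stream. replace (C * t) with ((t - 0) * C) by ring.
  apply abs_RInt_le_const; auto; [lra|]. intros s Hs.
  unfold extend0. destruct (Rle_dec s 0); [rewrite Rabs_R0; auto|].
  assert (Hs' : 0 < s) by lra.
  generalize (HE s Hs') (proj1 (Hbd s th Hs')). nra. }
assert (B2 : forall t th, 0 < t -> Rabs (stream g t th) <= C / beta).
{ intros t th Ht. unfold stream.
  assert (I : is_RInt (fun s => C * exp (- beta * s)) 0 t
    (minus (- C / beta * exp (- beta * t)) (- C / beta * exp (- beta * 0)))).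
  { apply (is_RInt_derive (fun s => - C / beta * exp (- beta * s))).
    - intros s _. auto_derive; auto. field; lra.
    - intros s _. apply (ex_derive_continuous (V := R_NormedModule)). auto_derive; auto. }
  apply Rle_trans with (RInt (fun s => Rabs (extend0 g s th)) 0 t); [apply abs_RInt_le; auto; lra|].
  apply Rle_trans with (RInt (fun s => C * exp (- beta * s)) 0 t).
  - apply RInt_le; try lra.
    + apply (ex_RInt_continuous (fun s => Rabs (extend0 g s th))). intros s _.
      apply (continuous_comp (fun s => extend0 g s th) Rabs); auto. apply continuous_Rabs.
    + eexists; exact I.
    + intros s Hs. rewrite extend0_pos by lra. apply Hbd; lra.
  - rewrite (is_RInt_unique _ _ _ _ I). unfold minus, plus, opp; simpl.
    replace (- beta * 0) with 0 by ring. rewrite exp_0.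
    assert (0 <= C / beta * exp (- beta * t)).
    { apply Rmult_le_pos; [|left; apply exp_pos]. apply Rmult_le_pos; auto.
      left; apply Rinv_0_lt_compat, Hb. }
    lra. }
(* the flux through an arc and the two rays joining it to the circle is zero *)
assert (J : forall t th1 th2, 0 < t ->
  RInt (f t) th1 th2 + (stream g t th2 - stream g t th1) = 0).
{ intros t th1 th2 Ht.
  set (J := fun t => RInt (f t) th1 th2 + (stream g t th2 - stream g t th1) : R).
  assert (HJ : forall t, 0 < t -> is_derive J t 0).
  { intros s Hs.
    replace 0 with (RInt (fun th => - gth s th) th1 th2 + (g s th2 - g s th1)).
    - unfold J. apply (is_derive_plus (V := R_NormedModule)).
      + apply (is_derive_RInt_slice f (fun t th => - gth t th)); auto;
          intros r th Hr; apply (Cf r th Hr).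
      + apply (is_derive_minus (V := R_NormedModule)); auto.
    - assert (I : is_RInt (fun th => - gth s th) th1 th2 (minus (- g s th2) (- g s th1))).
      { apply (is_RInt_derive (fun th => - g s th)).
        - intros th _. apply (is_derive_opp (V := R_NormedModule)). apply (Cg s th Hs).
        - intros th _. apply (continuity_2d_slice (fun t th => - gth t th)). apply (Cf s th Hs). }
      rewrite (is_RInt_unique _ _ _ _ I). unfold minus, plus, opp; simpl. ring. }
  assert (HJb : forall s, 0 < s -> Rabs (J s) <= (Rabs (th2 - th1) + 2) * C * s).
  { intros s Hs. unfold J.
    assert (K : Rabs (RInt (f s) th1 th2) <= Rabs (th2 - th1) * (C * s)).
    { assert (L : forall p q, p <= q -> Rabs (RInt (f s) p q) <= Rabs (q - p) * (C * s)).
      { intros p q Hpq. rewrite (Rabs_pos_eq (q - p)) by lra.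
        apply abs_RInt_le_const; auto.
        - apply ex_RInt_slice. intros; apply (Cf s th Hs).
        - intros; apply Hbd, Hs. }
      destruct (Rle_dec th1 th2); [apply L; auto|].
      rewrite <- (opp_RInt_swap (V := R_CompleteNormedModule)).
      - change (Rabs (- RInt (f s) th2 th1) <= Rabs (th2 - th1) * (C * s)).
        rewrite Rabs_Ropp, Rabs_minus_sym. apply L; lra.
      - apply ex_RInt_slice. intros; apply (Cf s th Hs). }
    generalize (B1 s th1 Hs) (B1 s th2 Hs). intros L1 L2.
    apply Rabs_le_between in K. apply Rabs_le_between in L1. apply Rabs_le_between in L2.
    apply Rabs_le; lra. }
  assert (M1 := derive_nonpos_decr J (fun _ => 0) HJ ltac:(intros; lra)).
  assert (M2 : forall s t, 0 < s <= t -> - J t <= - J s).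
  { apply (derive_nonpos_decr (fun t => - J t) (fun _ => 0)); [|intros; lra].
    intros s Hs. replace 0 with (- 0) by ring.
    apply (is_derive_opp (V := R_NormedModule)). auto. }
  change (J t = 0).
  set (K := (Rabs (th2 - th1) + 2) * C) in *.
  assert (HK : 0 <= K).
  { unfold K; apply Rmult_le_pos; auto. generalize (Rabs_pos (th2 - th1)); lra. }
  destruct (Req_dec (J t) 0) as [Z|Z]; auto. exfalso.
  assert (A : 0 < Rabs (J t)) by (apply Rabs_pos_lt, Z).
  set (s := Rmin t (Rabs (J t) / (2 * (K + 1)))).
  assert (Hs : 0 < s) by (apply Rmin_pos; [lra|apply Rdiv_lt_0_compat; lra]).
  assert (Hst : s <= t) by apply Rmin_l.
  assert (Hs2 : s <= Rabs (J t) / (2 * (K + 1))) by apply Rmin_r.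
  assert (s * (2 * (K + 1)) <= Rabs (J t)).
  { apply Rmult_le_reg_r with (/ (2 * (K + 1))); [apply Rinv_0_lt_compat; lra|].
    rewrite Rmult_assoc, Rinv_r by lra. lra. }
  assert (E : J t = J s) by (generalize (M1 s t ltac:(lra)) (M2 s t ltac:(lra)); lra).
  generalize (HJb s Hs). rewrite <- E. nra. }
assert (Hdth : forall t th, 0 < t -> is_derive (fun r => stream g t r) th (- f t th)).
{ intros t th Ht.
  apply (is_derive_ext (fun r => stream g t 0 - RInt (f t) 0 r)).
  - intros r. generalize (J t 0 r Ht). intros; lra.
  - replace (- f t th) with (0 - f t th) by ring.
    apply (is_derive_minus (V := R_NormedModule)); [apply is_derive_constR|].
    apply (is_derive_RInt (f t) (RInt (f t) 0) 0 th).
    + apply filter_forall; intros; apply (@RInt_correct R_CompleteNormedModule).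
      apply ex_RInt_slice. intros; apply (Cf t th0 Ht).
    + apply continuity_2d_slice. apply (Cf t th Ht). }
split; [|split].
- intros t th Ht. split; [|split; [|split; [|split]]]; auto.
  + apply (continuity_2d_partials (stream g) g t th (- f t th)); auto. apply (Cg t th Ht).
  + apply (Cg t th Ht).
  + apply continuity_2d_pt_opp. apply (Cf t th Ht).
- intros t th Ht. unfold stream. apply RInt_ext. intros s Hs.
  rewrite Rmin_left, Rmax_right in Hs by lra. rewrite !extend0_pos by lra. apply Hper; lra.
- auto.
Qed.

(** * Head pressure and vorticity *)

(** The square of the radius, the scalar vorticity, the components [r u_r] and
    [r u_theta], and the head pressure [p + |u|^2 / 2] of a plane vector field. *)
Definition rad2 : scalar_field := f_add (f_mul coord_x coord_x) (f_mul coord_y coord_y).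
Definition curl (u1 u2 : scalar_field) : scalar_field := f_sub (dx u2) (dy u1).
Definition r_radial (u1 u2 : scalar_field) : scalar_field :=
  f_add (f_mul coord_x u1) (f_mul coord_y u2).
Definition r_angular (u1 u2 : scalar_field) : scalar_field :=
  f_sub (f_mul coord_x u2) (f_mul coord_y u1).
Definition head_pressure (u1 u2 p : scalar_field) : scalar_field :=
  f_add p (f_mul (f_const (1 / 2)) (f_add (f_mul u1 u1) (f_mul u2 u2))).

Lemma smooth_rad2 : smooth rad2.
Proof. unfold rad2; auto with smooth. Qed.
Lemma smooth_curl u1 u2 : smooth u1 -> smooth u2 -> smooth (curl u1 u2).
Proof. unfold curl; auto with smooth. Qed.
Lemma smooth_r_radial u1 u2 : smooth u1 -> smooth u2 -> smooth (r_radial u1 u2).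
Proof. unfold r_radial; auto with smooth. Qed.
Lemma smooth_r_angular u1 u2 : smooth u1 -> smooth u2 -> smooth (r_angular u1 u2).
Proof. unfold r_angular; auto with smooth. Qed.
Lemma smooth_head_pressure u1 u2 p :
  smooth u1 -> smooth u2 -> smooth p -> smooth (head_pressure u1 u2 p).
Proof. unfold head_pressure; auto 8 with smooth. Qed.
#[global] Hint Resolve smooth_rad2 smooth_curl smooth_r_radial smooth_r_angular smooth_head_pressure : smooth.

Lemma rad2_E x y : rad2 x y = x * x + y * y.
Proof. reflexivity. Qed.

(** The momentum equation in polar form.  Since [(u . grad) u = om u^perp +
    grad |u|^2 / 2] and [Delta u = grad^perp om] for divergence-free [u], the gradient
    of the head pressure involves only the vorticity [om] and its gradient. *)
Lemma momentum_head_pressure u1 u2 p :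
  smooth u1 -> smooth u2 -> smooth p ->
  (forall x y, exterior x y ->
     u1 x y * dx u1 x y + u2 x y * dy u1 x y + dx p x y = dx (dx u1) x y + dy (dy u1) x y /\
     u1 x y * dx u2 x y + u2 x y * dy u2 x y + dy p x y = dx (dx u2) x y + dy (dy u2) x y /\
     dx u1 x y + dy u2 x y = 0) ->
  forall x y, exterior x y ->
    D_theta (head_pressure u1 u2 p) x y
      = D_t (curl u1 u2) x y - r_radial u1 u2 x y * curl u1 u2 x y /\
    D_t (head_pressure u1 u2 p) x y
      = - D_theta (curl u1 u2) x y + r_angular u1 u2 x y * curl u1 u2 x y.
Proof.
intros H1 H2 Hp HNS x y H.
assert (E : eqx (f_add (dx u1) (dy u2)) (f_const 0)).
{ intros a b Hab. apply (HNS a b Hab). }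
assert (E1 := dx_eqx _ _ E x y H). assert (E2 := dy_eqx _ _ E x y H).
rewrite dx_f_add, dx_f_const in E1 by auto with smooth.
rewrite dy_f_add, dy_f_const in E2 by auto with smooth.
destruct (HNS x y H) as (N1 & N2 & N3).
unfold head_pressure, curl, r_radial, r_angular. expand_derivatives.
rewrite (dx_dy u2) in E1 by auto. rewrite !(dx_dy u1) by auto.
assert (P1 : dx p x y
  = dx (dx u1) x y + dy (dy u1) x y - u1 x y * dx u1 x y - u2 x y * dy u1 x y) by lra.
assert (P2 : dy p x y
  = dx (dx u2) x y + dy (dy u2) x y - u1 x y * dx u2 x y - u2 x y * dy u2 x y) by lra.
rewrite P1, P2.
replace (dx (dx u1) x y) with (- dy (dx u2) x y) by lra.
replace (dy (dy u2) x y) with (- dy (dx u1) x y) by lra.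
split; [field|].
replace (dx u1 x y) with (- dy u2 x y) by lra. field.
Qed.

(** Rational expressions of the components of the reference field, valid on the
    exterior. *)
Definition ref_comp1 (phi mu : R) : scalar_field :=
  f_mul (f_sub (f_mul (f_const (- phi)) coord_x) (f_mul (f_const mu) coord_y)) (f_inv rad2).
Definition ref_comp2 (phi mu : R) : scalar_field :=
  f_mul (f_add (f_mul (f_const (- phi)) coord_y) (f_mul (f_const mu) coord_x)) (f_inv rad2).

Lemma rad2_gt1 x y : exterior x y -> 1 < rad2 x y.
Proof. intros H. apply exterior_sq in H. rewrite rad2_E. lra. Qed.

Lemma rad_sq x y : rad x y * rad x y = rad2 x y.
Proof. unfold rad. rewrite sqrt_sqrt; [rewrite rad2_E; ring|nra]. Qed.

Lemma u_ref_comp1 phi mu : eqx (comp1 (u_ref phi mu)) (ref_comp1 phi mu).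
Proof.
intros x y H. unfold comp1, u_ref, ref_comp1, e_r, e_theta, f_mul, f_sub, f_const, f_inv, coord_x, coord_y; simpl.
rewrite <- rad_sq. unfold exterior in H. field. lra.
Qed.
Lemma u_ref_comp2 phi mu : eqx (comp2 (u_ref phi mu)) (ref_comp2 phi mu).
Proof.
intros x y H. unfold comp2, u_ref, ref_comp2, e_r, e_theta, f_mul, f_add, f_const, f_inv, coord_x, coord_y; simpl.
rewrite <- rad_sq. unfold exterior in H. field. lra.
Qed.

Lemma smooth_inv_rad2 : smooth (f_inv rad2).
Proof.
apply smooth_f_inv; auto with smooth. intros x y H. generalize (rad2_gt1 x y H); lra.
Qed.
#[global] Hint Resolve smooth_inv_rad2 : smooth.

Lemma smooth_u_ref_comp1 phi mu : smooth (comp1 (u_ref phi mu)).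
Proof.
apply (smooth_eqx (ref_comp1 phi mu)); [apply eqx_sym, u_ref_comp1|].
unfold ref_comp1; auto 8 with smooth.
Qed.
Lemma smooth_u_ref_comp2 phi mu : smooth (comp2 (u_ref phi mu)).
Proof.
apply (smooth_eqx (ref_comp2 phi mu)); [apply eqx_sym, u_ref_comp2|].
unfold ref_comp2; auto 8 with smooth.
Qed.
#[global] Hint Resolve smooth_u_ref_comp1 smooth_u_ref_comp2 : smooth.

(** The reference field is irrotational, with constant [r u_r] and [r u_theta]. *)
Lemma u_ref_facts phi mu x y : exterior x y ->
  r_radial (comp1 (u_ref phi mu)) (comp2 (u_ref phi mu)) x y = - phi /\
  r_angular (comp1 (u_ref phi mu)) (comp2 (u_ref phi mu)) x y = mu /\
  curl (comp1 (u_ref phi mu)) (comp2 (u_ref phi mu)) x y = 0.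
Proof.
intros H. assert (K := rad2_gt1 x y H). split; [|split].
- unfold r_radial. rewrite f_addE, !f_mulE, u_ref_comp1, u_ref_comp2 by auto.
  unfold ref_comp1, ref_comp2, f_mul, f_sub, f_add, f_const, f_inv, coord_x, coord_y.
  rewrite rad2_E in K |- *. field. lra.
- unfold r_angular. rewrite f_subE, !f_mulE, u_ref_comp1, u_ref_comp2 by auto.
  unfold ref_comp1, ref_comp2, f_mul, f_sub, f_add, f_const, f_inv, coord_x, coord_y.
  rewrite rad2_E in K |- *. field. lra.
- unfold curl. rewrite f_subE.
  rewrite (dx_eqx _ _ (u_ref_comp2 phi mu)), (dy_eqx _ _ (u_ref_comp1 phi mu)) by auto.
  unfold ref_comp1, ref_comp2. expand_derivatives.
  rewrite dx_f_inv, dy_f_inv by (auto with smooth; lra).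
  unfold f_inv. rewrite rad2_E in K |- *. unfold rad2. expand_derivatives. field. lra.
Qed.

(** * The system for the difference of two solutions *)

Lemma D_t_eqx f g : eqx f g -> eqx (D_t f) (D_t g).
Proof.
intros E x y H. unfold D_t. rewrite !f_addE, !f_mulE, (dx_eqx _ _ E), (dy_eqx _ _ E); auto.
Qed.
Lemma D_theta_eqx f g : eqx f g -> eqx (D_theta f) (D_theta g).
Proof.
intros E x y H. unfold D_theta. rewrite !f_subE, !f_mulE, (dx_eqx _ _ E), (dy_eqx _ _ E); auto.
Qed.
Lemma D_t_f_sub f g x y : smooth f -> smooth g -> exterior x y ->
  D_t (f_sub f g) x y = D_t f x y - D_t g x y.
Proof. intros Hf Hg H; expand_derivatives; ring. Qed.
Lemma D_theta_f_sub f g x y : smooth f -> smooth g -> exterior x y ->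
  D_theta (f_sub f g) x y = D_theta f x y - D_theta g x y.
Proof. intros Hf Hg H; expand_derivatives; ring. Qed.
Lemma D_t_rad2 f x y : smooth f -> exterior x y ->
  D_t (f_mul rad2 f) x y = 2 * rad2 x y * f x y + rad2 x y * D_t f x y.
Proof. intros Hf H; unfold rad2; expand_derivatives; ring. Qed.
Lemma D_theta_rad2 f x y : smooth f -> exterior x y ->
  D_theta (f_mul rad2 f) x y = rad2 x y * D_theta f x y.
Proof. intros Hf H; unfold rad2; expand_derivatives; ring. Qed.

Lemma curl_f_sub u1 u2 w1 w2 : smooth u1 -> smooth u2 -> smooth w1 -> smooth w2 ->
  eqx (curl (f_sub u1 w1) (f_sub u2 w2)) (f_sub (curl u1 u2) (curl w1 w2)).
Proof. intros H1 H2 H3 H4 x y H. unfold curl. expand_derivatives. ring. Qed.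

(** Definition of the vorticity and incompressibility, in polar form. *)
Lemma polar_kinematics w1 w2 x y : smooth w1 -> smooth w2 -> exterior x y ->
  dx w1 x y + dy w2 x y = 0 ->
  D_t (r_angular w1 w2) x y - D_theta (r_radial w1 w2) x y = f_mul rad2 (curl w1 w2) x y /\
  D_t (r_radial w1 w2) x y = - D_theta (r_angular w1 w2) x y.
Proof.
intros H1 H2 H Hdiv. unfold r_angular, r_radial, curl, rad2. expand_derivatives. split; [ring|].
replace (dx w1 x y) with (- dy w2 x y) by lra. ring.
Qed.

(** The Navier-Stokes equations on the exterior, written with [dx] and [dy]. *)
Definition NS_exterior (u1 u2 p : scalar_field) : Prop := forall x y, exterior x y ->
     u1 x y * dx u1 x y + u2 x y * dy u1 x y + dx p x y = dx (dx u1) x y + dy (dy u1) x y /\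
     u1 x y * dx u2 x y + u2 x y * dy u2 x y + dy p x y = dx (dx u2) x y + dy (dy u2) x y /\
     dx u1 x y + dy u2 x y = 0.

(** The equations for the difference [w] of two solutions, in terms of the deviations
    [va], [vb] from the reference field.  The first relation expresses the equality
    of the mixed derivatives of the pressure. *)
Lemma polar_dynamics phi mu ua1 ua2 pa ub1 ub2 pb
  (va1 := f_sub ua1 (comp1 (u_ref phi mu))) (va2 := f_sub ua2 (comp2 (u_ref phi mu)))
  (vb1 := f_sub ub1 (comp1 (u_ref phi mu))) (vb2 := f_sub ub2 (comp2 (u_ref phi mu)))
  (w1 := f_sub vb1 va1) (w2 := f_sub vb2 va2)
  (z := f_mul rad2 (curl w1 w2)) (Pi := f_sub (head_pressure ub1 ub2 pb) (head_pressure ua1 ua2 pa))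
  (a := f_mul rad2 (D_theta Pi)) (b := f_mul rad2 (D_t Pi)) x y :
  smooth ua1 -> smooth ua2 -> smooth pa -> smooth ub1 -> smooth ub2 -> smooth pb ->
  NS_exterior ua1 ua2 pa -> NS_exterior ub1 ub2 pb -> exterior x y ->
  D_t a x y - D_theta b x y = 2 * a x y /\
  a x y = D_t z x y + (phi - 2) * z x y - r_radial vb1 vb2 x y * z x y
          - r_radial w1 w2 x y * f_mul rad2 (curl va1 va2) x y /\
  b x y = - D_theta z x y + (mu + r_angular vb1 vb2 x y) * z x y
          + r_angular w1 w2 x y * f_mul rad2 (curl va1 va2) x y.
Proof.
intros Ha1 Ha2 Hpa Hb1 Hb2 Hpb NSa NSb H.
assert (Sa1 : smooth va1) by (unfold va1; auto with smooth).
assert (Sa2 : smooth va2) by (unfold va2; auto with smooth).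
assert (Sb1 : smooth vb1) by (unfold vb1; auto with smooth).
assert (Sb2 : smooth vb2) by (unfold vb2; auto with smooth).
assert (SP : smooth Pi) by (unfold Pi; auto with smooth).
assert (Sw : smooth (curl w1 w2)) by (unfold w1, w2; auto with smooth).
split.
{ unfold a, b. rewrite D_t_rad2, D_theta_rad2, D_t_D_theta, f_mulE by auto with smooth. ring. }
destruct (momentum_head_pressure ua1 ua2 pa Ha1 Ha2 Hpa NSa x y H) as [Ma1 Ma2].
destruct (momentum_head_pressure ub1 ub2 pb Hb1 Hb2 Hpb NSb x y H) as [Mb1 Mb2].
assert (Ca : eqx (curl ua1 ua2) (curl va1 va2)).
{ intros s t K. unfold va1, va2. rewrite curl_f_sub by auto with smooth.
  rewrite f_subE. destruct (u_ref_facts phi mu s t K) as (_ & _ & ->). ring. }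
assert (Cb : eqx (curl ub1 ub2) (curl vb1 vb2)).
{ intros s t K. unfold vb1, vb2. rewrite curl_f_sub by auto with smooth.
  rewrite f_subE. destruct (u_ref_facts phi mu s t K) as (_ & _ & ->). ring. }
assert (Cw : eqx (curl w1 w2) (f_sub (curl vb1 vb2) (curl va1 va2))).
{ apply curl_f_sub; auto. }
destruct (u_ref_facts phi mu x y H) as (R1 & R2 & _).
assert (Fb : r_radial ub1 ub2 x y = - phi + r_radial vb1 vb2 x y).
{ rewrite <- R1. unfold vb1, vb2, r_radial. expand_derivatives. ring. }
assert (Gb : r_angular ub1 ub2 x y = mu + r_angular vb1 vb2 x y).
{ rewrite <- R2. unfold vb1, vb2, r_angular. expand_derivatives. ring. }
assert (Fa : r_radial ua1 ua2 x y = r_radial ub1 ub2 x y - r_radial w1 w2 x y).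
{ unfold w1, w2, va1, va2, vb1, vb2, r_radial. expand_derivatives. ring. }
assert (Ga : r_angular ua1 ua2 x y = r_angular ub1 ub2 x y - r_angular w1 w2 x y).
{ unfold w1, w2, va1, va2, vb1, vb2, r_angular. expand_derivatives. ring. }
unfold a, b, z, Pi.
rewrite !D_t_rad2, !D_theta_rad2, !f_mulE by auto with smooth.
rewrite D_theta_f_sub, D_t_f_sub by auto with smooth.
rewrite Ma1, Ma2, Mb1, Mb2.
rewrite (D_t_eqx _ _ Ca), (D_t_eqx _ _ Cb), (D_theta_eqx _ _ Ca), (D_theta_eqx _ _ Cb) by auto.
rewrite (Ca x y), (Cb x y), (Cw x y), (D_t_eqx _ _ Cw), (D_theta_eqx _ _ Cw) by auto.
rewrite D_t_f_sub, D_theta_f_sub by auto with smooth. rewrite f_subE.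
rewrite Fa, Ga, Fb, Gb.
split; ring.
Qed.

(** * Weighted bounds *)

Lemma rad_le_l p q : Rabs p <= rad p q.
Proof.
unfold rad. rewrite <- sqrt_Rsqr_abs. apply sqrt_le_1_alt. unfold Rsqr. nra.
Qed.
Lemma rad_le_r p q : Rabs q <= rad p q.
Proof.
unfold rad. rewrite <- sqrt_Rsqr_abs. apply sqrt_le_1_alt. unfold Rsqr. nra.
Qed.

Lemma r_radial_bound u1 u2 x y : Rabs (r_radial u1 u2 x y) <= rad x y * rad (u1 x y) (u2 x y).
Proof.
unfold r_radial. rewrite f_addE, !f_mulE. unfold coord_x, coord_y, rad.
rewrite <- sqrt_mult by nra. rewrite <- sqrt_Rsqr_abs. apply sqrt_le_1_alt.
unfold Rsqr. generalize (pow2_ge_0 (x * u2 x y - y * u1 x y)). intros. nra.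
Qed.
Lemma r_angular_bound u1 u2 x y : Rabs (r_angular u1 u2 x y) <= rad x y * rad (u1 x y) (u2 x y).
Proof.
unfold r_angular. rewrite f_subE, !f_mulE. unfold coord_x, coord_y, rad.
rewrite <- sqrt_mult by nra. rewrite <- sqrt_Rsqr_abs. apply sqrt_le_1_alt.
unfold Rsqr. generalize (pow2_ge_0 (x * u1 x y + y * u2 x y)). intros. nra.
Qed.

Lemma grad_bounds v x y :
  Rabs (dx (comp1 v) x y) <= abs_grad v x y /\ Rabs (dy (comp1 v) x y) <= abs_grad v x y /\
  Rabs (dx (comp2 v) x y) <= abs_grad v x y /\ Rabs (dy (comp2 v) x y) <= abs_grad v x y.
Proof.
unfold abs_grad, dx, dy.
repeat split; rewrite <- sqrt_Rsqr_abs; apply sqrt_le_1_alt; rewrite Rsqr_pow2;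
 repeat match goal with |- context [partial_derive ?i ?j ?f x y ^ 2] =>
   generalize (pow2_ge_0 (partial_derive i j f x y));
   generalize (partial_derive i j f x y ^ 2) end; intros; lra.
Qed.

Lemma hess_bounds v x y :
  Rabs (dx (dx (comp1 v)) x y) <= abs_hess v x y /\
  Rabs (dx (dy (comp1 v)) x y) <= abs_hess v x y /\
  Rabs (dy (dy (comp1 v)) x y) <= abs_hess v x y /\
  Rabs (dx (dx (comp2 v)) x y) <= abs_hess v x y /\
  Rabs (dx (dy (comp2 v)) x y) <= abs_hess v x y /\
  Rabs (dy (dy (comp2 v)) x y) <= abs_hess v x y.
Proof.
change (dx (dx (comp1 v)) x y) with (partial_derive 2 0 (comp1 v) x y).
change (dx (dy (comp1 v)) x y) with (partial_derive 1 1 (comp1 v) x y).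
change (dy (dy (comp1 v)) x y) with (partial_derive 0 2 (comp1 v) x y).
change (dx (dx (comp2 v)) x y) with (partial_derive 2 0 (comp2 v) x y).
change (dx (dy (comp2 v)) x y) with (partial_derive 1 1 (comp2 v) x y).
change (dy (dy (comp2 v)) x y) with (partial_derive 0 2 (comp2 v) x y).
unfold abs_hess.
repeat split; rewrite <- sqrt_Rsqr_abs; apply sqrt_le_1_alt; rewrite Rsqr_pow2;
 repeat match goal with |- context [partial_derive ?i ?j ?f x y ^ 2] =>
   generalize (pow2_ge_0 (partial_derive i j f x y));
   generalize (partial_derive i j f x y ^ 2) end; intros; lra.
Qed.

Lemma weighted_size_le beta va vb mu eps :
  Rbar_lt (Rbar_plus (weighted_sup beta va vb) (Finite (Rabs mu))) (Finite eps) ->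
  forall x y, exterior x y -> weighted_size beta va vb x y <= eps.
Proof.
intros H x y Hxy.
destruct (Lub_Rbar_correct (fun s : R => exists x y : R,
    1 < rad x y /\ s = weighted_size beta va vb x y)) as [U _].
assert (K := U (weighted_size beta va vb x y) (ex_intro _ x (ex_intro _ y (conj Hxy eq_refl)))).
unfold weighted_sup in H. destruct (Lub_Rbar _) as [s| |]; simpl in H, K.
- generalize (Rabs_pos mu); lra.
- contradiction.
- contradiction.
Qed.

(** The weight [r^(1 + beta)] turns a bound on the weighted size into exponential decay
    in [t = ln r] of the scale-invariant quantities [r |v|], [r^2 |grad v|] and
    [r^3 |grad^2 v|]. *)
Lemma weighted_size_polar beta va vb eps t th : 0 < t ->
  weighted_size beta va vb (exp t * cos th) (exp t * sin th) <= eps ->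
  let x := exp t * cos th in let y := exp t * sin th in let r := exp t in
  r * (abs_vf va x y + abs_vf vb x y) + r ^ 2 * (abs_grad va x y + abs_grad vb x y)
    + r ^ 3 * (abs_hess va x y + abs_hess vb x y) <= eps * exp (- beta * t).
Proof.
intros Ht H x y r. unfold weighted_size in H. fold x y in H.
replace (rad x y) with r in H by (symmetry; apply rad_polar).
assert (E : Rpower r (1 + beta) = r * exp (beta * t)).
{ unfold Rpower, r. rewrite ln_exp, <- exp_plus. f_equal; ring. }
rewrite E in H.
assert (P : 0 < exp (- beta * t)) by apply exp_pos.
assert (E2 : exp (beta * t) * exp (- beta * t) = 1).
{ rewrite <- exp_plus, <- exp_0. f_equal; ring. }
apply (Rmult_le_compat_r (exp (- beta * t))) in H; [|lra].
set (V := abs_vf va x y + abs_vf vb x y) in *.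
set (G := abs_grad va x y + abs_grad vb x y) in *.
set (S := abs_hess va x y + abs_hess vb x y) in *.
replace (r * V + r ^ 2 * G + r ^ 3 * S)
  with (r * (exp (beta * t) * exp (- beta * t)) * (V + r * G + r ^ 2 * S))
  by (rewrite E2; ring).
lra.
Qed.

(** The boundary values are attained along rays. *)
Lemma boundary_limit (u : vector_field) :
  continuous_on (fun z : R * R => 1 <= rad (fst z) (snd z))
                (fun z : R * R => u (fst z) (snd z)) ->
  forall th e, 0 < e -> exists d, 0 < d /\ forall s, 0 < s < d ->
    Rabs (polar (comp1 u) s th - comp1 u (cos th) (sin th)) < e /\
    Rabs (polar (comp2 u) s th - comp2 u (cos th) (sin th)) < e.
Proof.
intros HC th e He.
assert (H1 : 1 <= rad (cos th) (sin th)).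
{ generalize (rad_polar 0 th). rewrite exp_0, !Rmult_1_l. lra. }
assert (L := HC (cos th, sin th) H1). simpl in L.
destruct (proj1 (filterlim_locally _ _) L (mkposreal e He)) as [d Hd].
assert (Hl : 0 < ln (1 + d)).
{ rewrite <- ln_1. apply ln_increasing; [lra|]. generalize (cond_pos d); lra. }
exists (ln (1 + d)). split; auto. intros s Hs.
assert (Es : 1 < exp s < 1 + d).
{ split.
  - rewrite <- exp_0. apply exp_increasing; lra.
  - rewrite <- (exp_ln (1 + d)); [apply exp_increasing; lra|]. generalize (cond_pos d); lra. }
assert (A : forall c, -1 <= c <= 1 -> Rabs (exp s * c - c) < d).
{ intros c Hc. replace (exp s * c - c) with ((exp s - 1) * c) by ring.
  rewrite Rabs_mult, Rabs_pos_eq by lra.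
  assert (Rabs c <= 1) by (apply Rabs_le; lra).
  generalize (Rabs_pos c). nra. }
assert (B := Hd (exp s * cos th, exp s * sin th)).
destruct B as [B1 B2].
- split; [apply (A (cos th)), COS_bound | apply (A (sin th)), SIN_bound].
- simpl. rewrite rad_polar. lra.
- split; [exact B1 | exact B2].
Qed.

Lemma scaled1 p r v M : Rabs p <= r -> r * Rabs v <= M -> Rabs (p * v) <= M.
Proof.
intros H1 H2. apply Rle_trans with (r * Rabs v); auto. apply prod_bound; lra.
Qed.
Lemma scaled2 p q r v M : Rabs p <= r -> Rabs q <= r -> r ^ 2 * Rabs v <= M ->
  Rabs (p * q * v) <= M.
Proof.
intros H1 H2 H3. apply Rle_trans with (r ^ 2 * Rabs v); auto. apply prod_bound; [|lra].
replace (r ^ 2) with (r * r) by ring. apply prod_bound; auto.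
Qed.

(** Closes a bound on the absolute value of a linear combination, from such bounds on
    its terms. *)
Ltac rabs := repeat match goal with H : Rabs ?p <= _ |- _ =>
  apply Rabs_le_between in H end; apply Rabs_le; lra.

(** Bounds for all the quantities in the polar system, from the scale-invariant bounds
    on [w] and its derivatives up to order two. *)
Lemma decay_bounds w1 w2 x y r M :
  smooth w1 -> smooth w2 -> exterior x y ->
  Rabs x <= r -> Rabs y <= r -> 0 <= r -> rad2 x y = r ^ 2 ->
  (r * Rabs (w1 x y) <= M /\ r * Rabs (w2 x y) <= M) ->
  (r ^ 2 * Rabs (dx w1 x y) <= M /\ r ^ 2 * Rabs (dy w1 x y) <= M /\
   r ^ 2 * Rabs (dx w2 x y) <= M /\ r ^ 2 * Rabs (dy w2 x y) <= M) ->
  (r ^ 3 * Rabs (dx (dy w1) x y) <= M /\ r ^ 3 * Rabs (dy (dy w1) x y) <= M /\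
   r ^ 3 * Rabs (dx (dx w2) x y) <= M /\ r ^ 3 * Rabs (dx (dy w2) x y) <= M) ->
  Rabs (r_angular w1 w2 x y) <= 2 * M /\ Rabs (r_radial w1 w2 x y) <= 2 * M /\
  Rabs (D_t (r_angular w1 w2) x y) <= 6 * M /\ Rabs (D_t (r_radial w1 w2) x y) <= 6 * M /\
  Rabs (f_mul rad2 (curl w1 w2) x y) <= 2 * M /\ Rabs (D_t (f_mul rad2 (curl w1 w2)) x y) <= 8 * M.
Proof.
intros S1 S2 H Hx Hy Hr Hr2 (A1 & A2) (B1 & B2 & B3 & B4) (C1 & C2 & C3 & C4).
assert (X1 := scaled1 x r _ M Hx A1). assert (X2 := scaled1 x r _ M Hx A2).
assert (Y1 := scaled1 y r _ M Hy A1). assert (Y2 := scaled1 y r _ M Hy A2).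
assert (Er : Rabs r <= r) by (rewrite Rabs_pos_eq; lra).
assert (Z1 := scaled2 r r r _ M Er Er B2). assert (Z2 := scaled2 r r r _ M Er Er B3).
assert (T : forall p q v, Rabs p <= r -> Rabs q <= r -> r ^ 2 * Rabs v <= M ->
   Rabs (p * q * v) <= M) by (intros; eapply scaled2; eauto).
assert (U : forall p v, Rabs p <= r -> r ^ 3 * Rabs v <= M -> Rabs (r ^ 2 * (p * v)) <= M).
{ intros p v K1 K2. replace (r ^ 2 * (p * v)) with (p * r * (r * v)) by ring.
  apply (scaled2 p r r); auto. rewrite Rabs_mult, (Rabs_pos_eq r) by lra. lra. }
split; [|split; [|split; [|split; [|split]]]].
- unfold r_angular; expand_derivatives. rabs.
- unfold r_radial; expand_derivatives. rabs.
- unfold r_angular; expand_derivatives.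
  assert (K1 := T x x _ Hx Hx B3). assert (K2 := T x y _ Hx Hy B4).
  assert (K3 := T x y _ Hx Hy B1). assert (K4 := T y y _ Hy Hy B2). rabs.
- unfold r_radial; expand_derivatives.
  assert (K1 := T x x _ Hx Hx B1). assert (K2 := T x y _ Hx Hy B2).
  assert (K3 := T x y _ Hx Hy B3). assert (K4 := T y y _ Hy Hy B4). rabs.
- rewrite f_mulE, Hr2. unfold curl; expand_derivatives. rabs.
- rewrite D_t_rad2 by auto with smooth. rewrite Hr2. unfold curl; expand_derivatives.
  rewrite <- (dx_dy w2) by auto.
  assert (K1 := U x _ Hx C3). assert (K2 := U x _ Hx C1).
  assert (K3 := U y _ Hy C4). assert (K4 := U y _ Hy C2). rabs.
Qed.

Lemma polar_coords x y : 1 < rad x y ->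
  exists t th, 0 < t /\ x = exp t * cos th /\ y = exp t * sin th.
Proof.
intros H. set (r := rad x y) in *.
assert (Hr : r * r = x * x + y * y) by apply rad_sq.
exists (ln r).
assert (Hl : 0 < ln r) by (rewrite <- ln_1; apply ln_increasing; lra).
rewrite exp_ln by lra.
assert (B : -1 <= x / r <= 1).
{ assert (- r <= x <= r) by (split; nra).
  split; apply Rmult_le_reg_r with r; try lra; unfold Rdiv; rewrite Rmult_assoc, Rinv_l; lra. }
assert (Ss : sin (acos (x / r)) = Rabs y / r).
{ rewrite sin_acos by auto. rewrite <- (sqrt_Rsqr (Rabs y / r)).
  - f_equal. unfold Rdiv. rewrite !Rsqr_mult, <- Rsqr_abs. unfold Rsqr.
    replace (y * y) with (r * r - x * x) by lra. field. lra.
  - apply Rmult_le_pos; [apply Rabs_pos|left; apply Rinv_0_lt_compat; lra]. }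
destruct (Rle_dec 0 y).
- exists (acos (x / r)). rewrite cos_acos, Ss, Rabs_pos_eq by auto.
  repeat split; auto; field; lra.
- exists (- acos (x / r)). rewrite cos_neg, sin_neg, cos_acos, Ss, Rabs_left by lra.
  repeat split; auto; field; lra.
Qed.

(** * Uniqueness *)

(** Uniqueness in the open exterior, for every flux [phi > 2] and every circulation
    [mu], with an explicit smallness threshold for the deviations. *)
Lemma exterior_uniqueness phi beta eps mu (ustar ua ub : vector_field) (pa pb : scalar_field) :
  2 < phi -> 0 < beta -> 0 < eps -> eps <= 1 / 2 -> 5 * eps <= phi - 2 ->
  24 * eps <= (phi - 2) * beta ^ 2 ->
  smooth_vector_ext ua -> smooth_ext pa -> smooth_vector_ext ub -> smooth_ext pb ->
  ext_NS_solution ustar ua pa -> ext_NS_solution ustar ub pb ->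
  (forall x y, exterior x y ->
     weighted_size beta (vf_sub ua (u_ref phi mu)) (vf_sub ub (u_ref phi mu)) x y <= eps) ->
  forall x y, exterior x y -> ub x y = ua x y.
Proof.
intros Hphi Hb He He1 He2 He3 [Sa1 Sa2] Spa [Sb1 Sb2] Spb
  (NSa & Cona & Bca & _) (NSb & Conb & Bcb & _) Hsize.
apply smooth_of_smooth_ext in Sa1. apply smooth_of_smooth_ext in Sa2.
apply smooth_of_smooth_ext in Spa.
apply smooth_of_smooth_ext in Sb1. apply smooth_of_smooth_ext in Sb2.
apply smooth_of_smooth_ext in Spb.
set (ua1 := comp1 ua) in *. set (ua2 := comp2 ua) in *.
set (ub1 := comp1 ub) in *. set (ub2 := comp2 ub) in *.
set (va := vf_sub ua (u_ref phi mu)) in *. set (vb := vf_sub ub (u_ref phi mu)) in *.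
set (va1 := f_sub ua1 (comp1 (u_ref phi mu))). set (va2 := f_sub ua2 (comp2 (u_ref phi mu))).
set (vb1 := f_sub ub1 (comp1 (u_ref phi mu))). set (vb2 := f_sub ub2 (comp2 (u_ref phi mu))).
set (w1 := f_sub vb1 va1). set (w2 := f_sub vb2 va2).
assert (NSa' : NS_exterior ua1 ua2 pa) by exact NSa.
assert (NSb' : NS_exterior ub1 ub2 pb) by exact NSb.
assert (Sva1 : smooth va1) by (unfold va1; auto with smooth).
assert (Sva2 : smooth va2) by (unfold va2; auto with smooth).
assert (Svb1 : smooth vb1) by (unfold vb1; auto with smooth).
assert (Svb2 : smooth vb2) by (unfold vb2; auto with smooth).
assert (Sw1 : smooth w1) by (unfold w1; auto with smooth).
assert (Sw2 : smooth w2) by (unfold w2; auto with smooth).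
assert (Ew1 : forall x y, w1 x y = ub1 x y - ua1 x y) by (intros; unfold w1, vb1, va1, f_sub; ring).
assert (Ew2 : forall x y, w2 x y = ub2 x y - ua2 x y) by (intros; unfold w2, vb2, va2, f_sub; ring).
set (f := r_radial w1 w2). set (g := r_angular w1 w2). set (z := f_mul rad2 (curl w1 w2)).
set (Pi := f_sub (head_pressure ub1 ub2 pb) (head_pressure ua1 ua2 pa)).
set (a := f_mul rad2 (D_theta Pi)). set (b := f_mul rad2 (D_t Pi)).
set (FV := r_radial vb1 vb2). set (GV := r_angular vb1 vb2). set (Om := f_mul rad2 (curl va1 va2)).
assert (Sf' : smooth f) by (unfold f; auto with smooth).
assert (Sg : smooth g) by (unfold g; auto with smooth).
assert (Sz : smooth z) by (unfold z; auto with smooth).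
assert (SPi : smooth Pi) by (unfold Pi; auto with smooth).
assert (Sa : smooth a) by (unfold a; auto with smooth).
assert (Sb : smooth b) by (unfold b; auto with smooth).
set (k := phi - 2) in *.
assert (Hdiv : forall x y, exterior x y -> dx w1 x y + dy w2 x y = 0).
{ intros x y H. unfold w1, w2, vb1, vb2, va1, va2. expand_derivatives.
  destruct (NSa' x y H) as (_ & _ & K1). destruct (NSb' x y H) as (_ & _ & K2). lra. }
assert (Hkin : forall x y, exterior x y ->
  D_t g x y - D_theta f x y = z x y /\ D_t f x y = - D_theta g x y).
{ intros x y H. apply polar_kinematics; auto. }
assert (Hdyn : forall x y, exterior x y ->
  D_t a x y - D_theta b x y = 2 * a x y /\
  a x y = D_t z x y + k * z x y - FV x y * z x y - f x y * Om x y /\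
  b x y = - D_theta z x y + (mu + GV x y) * z x y + g x y * Om x y).
{ intros x y H. apply (polar_dynamics phi mu ua1 ua2 pa ub1 ub2 pb); auto. }
assert (HE : forall t, 0 < t -> 0 < exp (- beta * t) <= 1).
{ intros t Ht. split; [apply exp_pos|]. rewrite <- exp_0. left; apply exp_increasing. nra. }
(* every field of the system decays like exp (- beta t); for the three coefficients
   the constants matter *)
assert (Hsmall : forall t th, 0 < t ->
  Rabs (polar FV t th) <= eps * exp (- beta * t) /\
  Rabs (polar GV t th) <= eps * exp (- beta * t) /\
  Rabs (polar Om t th) <= 2 * eps * exp (- beta * t) /\
  Rabs (polar g t th) <= 2 * (eps * exp (- beta * t)) /\
  Rabs (polar f t th) <= 2 * (eps * exp (- beta * t)) /\
  Rabs (polar (D_t g) t th) <= 6 * (eps * exp (- beta * t)) /\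
  Rabs (polar (D_t f) t th) <= 6 * (eps * exp (- beta * t)) /\
  Rabs (polar z t th) <= 2 * (eps * exp (- beta * t)) /\
  Rabs (polar (D_t z) t th) <= 8 * (eps * exp (- beta * t))).
{ intros t th Ht.
  assert (Hx := exterior_polar t th Ht).
  assert (Hs := weighted_size_polar beta va vb eps t th Ht (Hsize _ _ Hx)).
  assert (Hrad := rad_polar t th).
  unfold polar. cbv zeta in Hs.
  set (x := exp t * cos th) in *. set (y := exp t * sin th) in *. set (r := exp t) in *.
  set (M := eps * exp (- beta * t)) in *.
  assert (Hr : 0 < r) by apply exp_pos.
  assert (Hr2 : rad2 x y = r ^ 2) by (rewrite <- rad_sq, Hrad; ring).
  assert (Hxr : Rabs x <= r) by (rewrite <- Hrad; apply rad_le_l).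
  assert (Hyr : Rabs y <= r) by (rewrite <- Hrad; apply rad_le_r).
  destruct (grad_bounds va x y) as (GA1 & GA2 & GA3 & GA4).
  destruct (grad_bounds vb x y) as (GB1 & GB2 & GB3 & GB4).
  destruct (hess_bounds va x y) as (HA1 & HA2 & HA3 & HA4 & HA5 & HA6).
  destruct (hess_bounds vb x y) as (HB1 & HB2 & HB3 & HB4 & HB5 & HB6).
  change (comp1 va) with va1 in *. change (comp2 va) with va2 in *.
  change (comp1 vb) with vb1 in *. change (comp2 vb) with vb2 in *.
  assert (VA1 : Rabs (va1 x y) <= abs_vf va x y) by apply rad_le_l.
  assert (VA2 : Rabs (va2 x y) <= abs_vf va x y) by apply rad_le_r.
  assert (VB1 : Rabs (vb1 x y) <= abs_vf vb x y) by apply rad_le_l.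
  assert (VB2 : Rabs (vb2 x y) <= abs_vf vb x y) by apply rad_le_r.
  assert (PV : 0 <= abs_vf va x y) by (generalize (Rabs_pos (va1 x y)); lra).
  assert (PV' : 0 <= abs_vf vb x y) by (generalize (Rabs_pos (vb1 x y)); lra).
  assert (PG : 0 <= abs_grad va x y) by (generalize (Rabs_pos (dx va1 x y)); lra).
  assert (PG' : 0 <= abs_grad vb x y) by (generalize (Rabs_pos (dx vb1 x y)); lra).
  assert (PH : 0 <= abs_hess va x y) by (generalize (Rabs_pos (dx (dx va1) x y)); lra).
  assert (PH' : 0 <= abs_hess vb x y) by (generalize (Rabs_pos (dx (dx vb1) x y)); lra).
  assert (Pr2 : 0 < r ^ 2) by (apply pow_lt, Hr).
  assert (Pr3 : 0 < r ^ 3) by (apply pow_lt, Hr).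
  set (Va := abs_vf va x y) in *. set (Vb := abs_vf vb x y) in *.
  set (Ga := abs_grad va x y) in *. set (Gb := abs_grad vb x y) in *.
  set (Ha := abs_hess va x y) in *. set (Hb' := abs_hess vb x y) in *.
  assert (Q1 : 0 <= r * (Va + Vb)) by (apply Rmult_le_pos; lra).
  assert (Q2 : 0 <= r ^ 2 * (Ga + Gb)) by (apply Rmult_le_pos; lra).
  assert (Q3 : 0 <= r ^ 3 * (Ha + Hb')) by (apply Rmult_le_pos; lra).
  assert (Q4 : r * Vb <= r * (Va + Vb)) by (apply Rmult_le_compat_l; lra).
  assert (Q5 : r ^ 2 * Ga <= r ^ 2 * (Ga + Gb)) by (apply Rmult_le_compat_l; lra).
  assert (D : forall q A B p p', 0 < q -> q * (A + B) <= M -> Rabs p <= A -> Rabs p' <= B ->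
     q * Rabs (p' - p) <= M).
  { intros q A B p p' Hq K1 K2 K3. apply Rle_trans with (q * (A + B)); auto.
    apply Rmult_le_compat_l; [lra|].
    apply Rabs_le_between in K2. apply Rabs_le_between in K3. apply Rabs_le; lra. }
  assert (K1 : r * (Va + Vb) <= M) by lra.
  assert (K2 : r ^ 2 * (Ga + Gb) <= M) by lra.
  assert (K3 : r ^ 3 * (Ha + Hb') <= M) by lra.
  assert (Ed11 : eqx (dx w1) (f_sub (dx vb1) (dx va1))) by (intros s u K; apply dx_f_sub; auto).
  assert (Ed12 : eqx (dx w2) (f_sub (dx vb2) (dx va2))) by (intros s u K; apply dx_f_sub; auto).
  assert (Ed21 : eqx (dy w1) (f_sub (dy vb1) (dy va1))) by (intros s u K; apply dy_f_sub; auto).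
  assert (Ed22 : eqx (dy w2) (f_sub (dy vb2) (dy va2))) by (intros s u K; apply dy_f_sub; auto).
  split; [|split; [|split]].
  - apply Rle_trans with (r * Vb); [|lra]. rewrite <- Hrad. apply r_radial_bound.
  - apply Rle_trans with (r * Vb); [|lra]. rewrite <- Hrad. apply r_angular_bound.
  - unfold Om. rewrite f_mulE, Hr2. unfold curl. rewrite f_subE.
    rewrite Rabs_mult, (Rabs_pos_eq (r ^ 2)) by lra.
    apply Rle_trans with (r ^ 2 * (2 * Ga)); [|unfold M in *; lra].
    apply Rmult_le_compat_l; [lra|]. rabs.
  - apply (decay_bounds w1 w2 x y r M); auto; [lra| | |].
    + unfold w1, w2. rewrite !f_subE. split; apply (D r Va Vb); auto.
    + rewrite Ed11, Ed12, Ed21, Ed22 by auto. rewrite !f_subE.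
      split; [|split; [|split]]; apply (D (r ^ 2) Ga Gb); auto.
    + rewrite (dx_eqx _ _ Ed21), (dy_eqx _ _ Ed21), (dx_eqx _ _ Ed12), (dx_eqx _ _ Ed22) by auto.
      rewrite !dx_f_sub, dy_f_sub by auto with smooth.
      split; [|split; [|split]]; apply (D (r ^ 3) Ha Hb'); auto. }
(* w vanishes on the circle since both solutions have the same boundary values *)
assert (Hlim : forall th e, 0 < e -> exists d, 0 < d /\ forall s, 0 < s < d ->
   Rabs (polar w1 s th) < e /\ Rabs (polar w2 s th) < e).
{ intros th e He0.
  destruct (boundary_limit ua Cona th (e / 2) ltac:(lra)) as [da [Hda Ka]].
  destruct (boundary_limit ub Conb th (e / 2) ltac:(lra)) as [db [Hdb Kb]].
  assert (Hc : rad (cos th) (sin th) = 1).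
  { generalize (rad_polar 0 th). rewrite exp_0, !Rmult_1_l. auto. }
  assert (Eab : ub (cos th) (sin th) = ua (cos th) (sin th)) by (rewrite Bca, Bcb; auto).
  exists (Rmin da db). split; [apply Rmin_pos; auto|]. intros s Hs.
  generalize (Rmin_l da db) (Rmin_r da db); intros L1 L2.
  destruct (Ka s ltac:(lra)) as [A1 A2]. destruct (Kb s ltac:(lra)) as [B1 B2].
  unfold comp1 at 2 in B1. unfold comp2 at 2 in B2. rewrite Eab in B1, B2.
  change (fst (ua (cos th) (sin th))) with (comp1 ua (cos th) (sin th)) in B1.
  change (snd (ua (cos th) (sin th))) with (comp2 ua (cos th) (sin th)) in B2.
  unfold polar in *. rewrite Ew1, Ew2.
  change (comp1 ua) with ua1 in A1, B1. change (comp2 ua) with ua2 in A2, B2.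
  change (comp1 ub) with ub1 in B1. change (comp2 ub) with ub2 in B2.
  apply Rabs_def2 in A1. apply Rabs_def2 in A2. apply Rabs_def2 in B1. apply Rabs_def2 in B2.
  split; apply Rabs_def1; lra. }
assert (Hlim' : forall h, (h = f \/ h = g) -> forall th e, 0 < e -> exists d, 0 < d /\
   forall s, 0 < s < d -> Rabs (polar h s th) < e).
{ intros h Hh th e He0.
  destruct (Hlim th (e / 6) ltac:(lra)) as [d [Hd K]].
  exists (Rmin d 1). split; [apply Rmin_pos; lra|]. intros s Hs.
  generalize (Rmin_l d 1) (Rmin_r d 1); intros L1 L2.
  destruct (K s ltac:(lra)) as [A1 A2].
  assert (E3 : exp s <= 3).
  { apply Rle_trans with (exp 1); [left; apply exp_increasing; lra|apply exp_le_3]. }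
  assert (Ep := exp_pos s).
  assert (X : Rabs (exp s * cos th) <= 3) by (rewrite <- (rad_polar s th) in E3;
    eapply Rle_trans; [apply rad_le_l|exact E3]).
  assert (Y : Rabs (exp s * sin th) <= 3) by (rewrite <- (rad_polar s th) in E3;
    eapply Rle_trans; [apply rad_le_r|exact E3]).
  assert (S : forall p v, Rabs p <= 3 -> Rabs v < e / 6 -> Rabs (p * v) < e / 2).
  { intros p v K1 K2. rewrite Rabs_mult. generalize (Rabs_pos p) (Rabs_pos v). nra. }
  unfold polar in *.
  assert (T1 := S _ _ X A1). assert (T2 := S _ _ X A2).
  assert (T3 := S _ _ Y A1). assert (T4 := S _ _ Y A2).
  apply Rabs_def2 in T1. apply Rabs_def2 in T2. apply Rabs_def2 in T3. apply Rabs_def2 in T4.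
  destruct Hh as [-> | ->].
  - unfold f, r_radial. rewrite f_addE, !f_mulE. unfold coord_x, coord_y. apply Rabs_def1; lra.
  - unfold g, r_angular. rewrite f_subE, !f_mulE. unfold coord_x, coord_y. apply Rabs_def1; lra. }
(* large enough for all the bounds, the worst being the one on a: since eps <= 1/2,
   it is at most (12 + 2 k) eps exp (- beta t) *)
set (C0 := 16 + 2 * k).
assert (HC0 : 16 <= C0) by (unfold C0; unfold k; lra).
assert (HM : forall t, 0 < t -> 0 <= eps * exp (- beta * t) <= exp (- beta * t)).
{ intros t Ht. generalize (HE t Ht). intros. split; [apply Rmult_le_pos; lra|nra]. }
assert (Hlin : forall h, (h = f \/ h = g) -> forall t th, 0 < t -> Rabs (polar h t th) <= C0 * t).
{ intros h Hh t th Ht.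
  apply (linear_bound (fun s => polar h s th) (fun s => polar (D_t h) s th) C0); auto.
  - intros s Hs. apply polar_derive_t; auto. destruct Hh as [-> | ->]; auto.
  - intros s Hs. destruct (Hsmall s th Hs) as (_ & _ & _ & _ & _ & K1 & K2 & _).
    generalize (HM s Hs) (HE s Hs); intros.
    destruct Hh as [-> | ->]; lra. }
(* the t-derivative of f in the form - g_theta given by incompressibility *)
assert (PCf : polar_C1 (polar f) (fun t th => - polar (D_theta g) t th) (polar (D_theta f))).
{ intros t th Ht. destruct (polar_C1_polar f Sf' t th Ht) as (P1 & P2 & P3 & P4 & P5).
  assert (E : forall s r, 0 < s -> polar (D_t f) s r = - polar (D_theta g) s r).
  { intros s r Hs. apply (Hkin _ _ (exterior_polar s r Hs)). }
  split; [|split; [|split; [|split]]]; auto.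
  - rewrite <- E by auto. exact P1.
  - apply (continuity_2d_pt_ext_loc (polar (D_t f))); auto. apply locally_2d_pos; auto. }
assert (HC0p : 0 <= C0) by lra.
destruct (stream_spec (polar g) (polar (D_t g)) (polar (D_theta g))
  (polar f) (polar (D_theta f)) beta C0)
  as (PCs & Pers & Bs); auto.
{ apply polar_C1_polar; auto. }
{ intros t th _; apply polar_periodic. }
{ intros t th Ht. destruct (Hsmall t th Ht) as (_ & _ & _ & K1 & _).
  generalize (HM t Ht) (HE t Ht); intros. split; [|split].
  - nra.
  - apply Hlin; auto.
  - apply Hlin; auto. }
set (C := C0 + C0 / beta).
assert (HCb : 0 < C0 / beta) by (apply Rdiv_lt_0_compat; lra).
assert (Hk : 0 < k) by (unfold k; lra).
assert (Hfin : forall t th, 0 < t -> polar g t th = 0 /\ polar f t th = 0).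
{ apply (polar_system_unique k beta eps mu C (polar a) (polar (D_t a)) (polar (D_theta a))
    (polar b) (polar (D_t b)) (polar (D_theta b))
    (polar z) (polar (D_t z)) (polar (D_theta z)) (polar g) (polar (D_t g)) (polar (D_theta g))
    (polar f) (polar (D_theta f)) (stream (polar g)) (polar FV) (polar GV) (polar Om));
      auto using polar_C1_polar.
  - unfold C; lra.
  - intros t th Ht. assert (Hx := exterior_polar t th Ht).
    destruct (Hkin _ _ Hx) as [R1 _]. destruct (Hdyn _ _ Hx) as (R2 & R3 & R4). auto.
  - intros t th Ht. rewrite !polar_periodic. repeat split. apply Pers, Ht.
  - intros t th Ht. destruct (Hsmall t th Ht) as (K1 & K2 & K3 & _). auto.
  - intros t th Ht. assert (Hx := exterior_polar t th Ht).
    destruct (Hsmall t th Ht) as (K1 & K2 & K3 & K4 & K5 & _ & _ & K6 & K7).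
    destruct (Hdyn _ _ Hx) as (_ & R3 & _).
    destruct (Bs t th Ht) as [B1 B2].
    assert (L1 := Hlin g (or_intror eq_refl) t th Ht).
    assert (L2 := Hlin f (or_introl eq_refl) t th Ht).
    assert (HEt := HE t Ht). assert (HMt := HM t Ht).
    set (E := exp (- beta * t)) in *.
    assert (G : forall p, Rabs p <= C0 * E -> Rabs p <= C * E).
    { intros p Hp. apply Rle_trans with (C0 * E); auto. apply Rmult_le_compat_r; unfold C; lra. }
    assert (G' : forall p, Rabs p <= C0 * t -> Rabs p <= C * t).
    { intros p Hp. apply Rle_trans with (C0 * t); auto. apply Rmult_le_compat_r; unfold C; lra. }
    assert (LC : 16 * E <= C0 * E) by (apply Rmult_le_compat_r; lra).
    repeat split; auto.
    + apply G; lra.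
    + apply G; lra.
    + apply G; lra.
    + apply G. unfold polar at 1. rewrite R3.
      change (Rabs (polar (D_t z) t th + k * polar z t th - polar FV t th * polar z t th
         - polar f t th * polar Om t th) <= C0 * E).
      set (m := eps * E) in *.
      assert (A1 : Rabs (k * polar z t th) <= k * (2 * m)).
      { apply prod_bound; auto. rewrite Rabs_pos_eq; lra. }
      assert (A2 : Rabs (polar FV t th * polar z t th) <= 1 * (2 * m)).
      { apply prod_bound; auto; lra. }
      assert (A3 : Rabs (polar f t th * polar Om t th) <= (2 * m) * 1).
      { apply prod_bound; auto. apply Rle_trans with (1 := K3). fold m in K3.
        unfold m in *; nra. }
      assert (A4 : k * (2 * m) <= 2 * k * E) by nra.
      apply Rle_trans with (8 * m + k * (2 * m) + 1 * (2 * m) + 2 * m * 1); [rabs|].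
      unfold C0. lra.
    + apply Rle_trans with (1 := B2). unfold C; lra. }
intros x y H.
destruct (polar_coords x y H) as (t & th & Ht & -> & ->).
destruct (Hfin t th Ht) as [Zg Zf].
unfold polar, g, f, r_angular, r_radial in Zg, Zf. rewrite f_subE, !f_mulE in Zg. rewrite f_addE, !f_mulE in Zf.
unfold coord_x, coord_y in Zg, Zf.
set (x := exp t * cos th) in *. set (y := exp t * sin th) in *.
assert (Hq := rad2_gt1 x y H). rewrite rad2_E in Hq.
assert (Z1 : w1 x y = 0).
{ apply Rmult_eq_reg_l with (x * x + y * y); [|lra].
  replace ((x * x + y * y) * w1 x y)
    with (x * (x * w1 x y + y * w2 x y) - y * (x * w2 x y - y * w1 x y)) by ring.
  rewrite Zg, Zf; ring. }
assert (Z2 : w2 x y = 0).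
{ apply Rmult_eq_reg_l with (x * x + y * y); [|lra].
  replace ((x * x + y * y) * w2 x y)
    with (y * (x * w1 x y + y * w2 x y) + x * (x * w2 x y - y * w1 x y)) by ring.
  rewrite Zg, Zf; ring. }
rewrite Ew1 in Z1. rewrite Ew2 in Z2.
rewrite (surjective_pairing (ub x y)), (surjective_pairing (ua x y)).
f_equal; [change (ub1 x y = ua1 x y) | change (ub2 x y = ua2 x y)]; lra.
Qed.

Theorem theorem2 :
  forall phi0 beta0 : R,
    21 / 10 < phi0 <= 3 -> 0 < beta0 ->
    exists eps : R, 0 < eps /\
      forall (mu : R) (ustar ua ub : vector_field) (pa pb : scalar_field),
        smooth_circle ustar ->
        smooth_vector_ext ua -> smooth_ext pa ->
        smooth_vector_ext ub -> smooth_ext pb ->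
        ext_NS_solution ustar ua pa ->
        ext_NS_solution ustar ub pb ->
        Rbar_lt
          (Rbar_plus
             (weighted_sup beta0 (vf_sub ua (u_ref phi0 mu))
                                 (vf_sub ub (u_ref phi0 mu)))
             (Finite (Rabs mu)))
          (Finite eps) ->
        forall x y : R, 1 <= rad x y -> ub x y = ua x y.
Proof.
intros phi beta [Hphi _] Hb.
assert (P : 0 < (phi - 2) * beta ^ 2) by (apply Rmult_lt_0_compat; [lra|apply pow_lt, Hb]).
(* the thresholds of density_bound for k = phi - 2 *)
set (eps := Rmin (1 / 2) (Rmin ((phi - 2) / 5) ((phi - 2) * beta ^ 2 / 24))).
assert (E1 : eps <= 1 / 2) by apply Rmin_l.
assert (E2 : eps <= (phi - 2) / 5) by (eapply Rle_trans; [apply Rmin_r|apply Rmin_l]).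
assert (E3 : eps <= (phi - 2) * beta ^ 2 / 24) by (eapply Rle_trans; [apply Rmin_r|apply Rmin_r]).
assert (E0 : 0 < eps) by (repeat apply Rmin_pos; lra).
exists eps. split; auto.
intros mu ustar ua ub pa pb _ Sa Spa Sb Spb NSa NSb Hsup x y Hxy.
destruct (Rle_lt_or_eq_dec 1 (rad x y) Hxy) as [K|K].
- apply (exterior_uniqueness phi beta eps mu ustar ua ub pa pb); auto; try lra.
  intros; eapply weighted_size_le; eauto.
- destruct NSa as (_ & _ & Ba & _). destruct NSb as (_ & _ & Bb & _).
  rewrite Ba, Bb; auto.
Qed.
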